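(* Let $H^2_\beta$ be the weighted Hardy space induced by a weight sequence $w=\{w_k\}_{k=1}^\infty$ with $w_k\to1$. Let $\varphi(z)=\frac{t-z}{1-tz}$, $t\in(0,1)$, be a M\''obius transformation on $\mathbb{D}$. If $M_z$ is strictly cyclic on $H^2_\beta$ and $$\lim_{k\to\infty}(k+1)(w_k-1)=+\infty,$$ then the Hermitian holomorphic vector bundle $E_{S_{\beta^{-1}}}(\mathbb{D})$ is not similar to the vector bundle $E_{\varphi(S_{\beta^{-1}})}(\mathbb{D})$.
   Context: $\mathbb{D}$ is the open unit disk. $\beta=\{\beta_k\}_{k\ge0}$ is a sequence of positive numbers with $\beta_0=1$ and $w_k=\beta_k/\beta_{k-1}$ ($k\ge1$). $H^2_\beta=\{f(z)=\sum_{k\ge0}\widehat f(k)z^k:\ \sum_k|\widehat f(k)|^2\beta_k^2<\infty\}$ with $\langle f,g\rangle=\sum_k\beta_k^2\,\widehat f(k)\overline{\widehat g(k)}$. $\beta^{-1}=\{1/\beta_k\}_{k\ge0}$, and $H^2_{\beta^{-1}}$ is the corresponding weighted Hardy space. $M_z$ is multiplication by $z$. A bounded operator $T$ on a Hilbert space $\mathcal{H}$ is strictly cyclic if the weakly closed algebra $\mathcal{A}$ generated by $T$ has a vector $f_0$ with $\mathcal{A}f_0=\mathcal{H}$. (For $M_z$ on $H^2_\beta$ this is equivalent to: every $f\in H^2_\beta$ is a bounded multiplier of $H^2_\beta$.) $S_{\beta^{-1}}$ is the bounded operator on $H^2_{\beta^{-1}}$ given by $S_{\beta^{-1}}f(z)=(f(z)-f(0))/z$,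 whose spectrum is $\overline{\mathbb{D}}$; $\varphi(S_{\beta^{-1}})$ is defined by the holomorphic functional calculus. $E_{S_{\beta^{-1}}}(\mathbb{D})$ and $E_{\varphi(S_{\beta^{-1}})}(\mathbb{D})$ are the Hermitian holomorphic vector bundles over $\mathbb{D}$ in $H^2_{\beta^{-1}}$ with fibres $\mathrm{Ker}(S_{\beta^{-1}}-\omega\mathbf{I})$ and $\mathrm{Ker}(\varphi(S_{\beta^{-1}})-\omega\mathbf{I})$, $\omega\in\mathbb{D}$. Two such bundles $E$, $\widetilde E$ over $\mathbb{D}$ are similar if there is a bounded invertible linear operator $X$ on $H^2_{\beta^{-1}}$ with $XE(\omega)=\widetilde E(\omega)$ for all $\omega\in\mathbb{D}$. *)

(* Defs.v *)
From Stdlib Require Import Reals List.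
From Coquelicot Require Import Coquelicot.

Open Scope R_scope.

(* A power series f(z) = sum_k f_k z^k is represented by its Taylor
   coefficients.  An operator is a total map on coefficient sequences, and only
   its values on the weighted Hardy space under consideration matter. *)
Definition pseries : Type := nat -> C.
Definition operator : Type := pseries -> pseries.

Definition fadd (f g : pseries) : pseries := fun k => (f k + g k)%C.
Definition fsub (f g : pseries) : pseries := fun k => (f k - g k)%C.
Definition fscal (c : C) (f : pseries) : pseries := fun k => (c * f k)%C.

(* w_k for k >= 1; the value at k = 0 is irrelevant. *)
Definition weight (beta : nat -> R) (k : nat) : R := beta k / beta (pred k).

Definition inv_seq (beta : nat -> R) : nat -> R := fun k => / beta k.

Definition H2 (beta : nat -> R) (f : pseries) : Prop :=
  ex_series (fun k => (Cmod (f k)) ^ 2 * (beta k) ^ 2).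

Definition CSeries (a : nat -> C) : C :=
  (Series (fun k => Re (a k)), Series (fun k => Im (a k))).

Definition inner (beta : nat -> R) (f g : pseries) : C :=
  CSeries (fun k => (RtoC ((beta k) ^ 2) * f k * Cconj (g k))%C).

Definition H2norm (beta : nat -> R) (f : pseries) : R :=
  sqrt (Series (fun k => (Cmod (f k)) ^ 2 * (beta k) ^ 2)).

Record bounded_operator (beta : nat -> R) (T : operator) : Prop := {
  bop_maps : forall f, H2 beta f -> H2 beta (T f);
  bop_add : forall f g, H2 beta f -> H2 beta g ->
    T (fadd f g) = fadd (T f) (T g);
  bop_scal : forall c f, H2 beta f -> T (fscal c f) = fscal c (T f);
  bop_bound : exists M : R, forall f, H2 beta f ->
    H2norm beta (T f) <= M * H2norm beta f
}.

(* T and U are mutually inverse on H2 beta. *)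
Definition inverse_on (beta : nat -> R) (T U : operator) : Prop :=
  forall f, H2 beta f -> U (T f) = f /\ T (U f) = f.

Definition bounded_invertible (beta : nat -> R) (X : operator) : Prop :=
  bounded_operator beta X /\
  exists Y, bounded_operator beta Y /\ inverse_on beta X Y.

(* T is in the closure of A for the weak operator topology: every basic weak
   neighbourhood of T, given by finitely many pairs of vectors, meets A. *)
Definition wot_adherent (beta : nat -> R) (A : operator -> Prop)
    (T : operator) : Prop :=
  forall (eps : R) (l : list (pseries * pseries)),
    0 < eps ->
    (forall p, In p l -> H2 beta (fst p) /\ H2 beta (snd p)) ->
    exists U, A U /\
      forall p, In p l ->
        Cmod (inner beta (fsub (T (fst p)) (U (fst p))) (snd p)) < eps.

Record weakly_closed_algebra (beta : nat -> R) (A : operator -> Prop) : Prop := {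
  wca_bounded : forall T, A T -> bounded_operator beta T;
  wca_id : A (fun f => f);
  wca_add : forall T U, A T -> A U -> A (fun f => fadd (T f) (U f));
  wca_scal : forall c T, A T -> A (fun f => fscal c (T f));
  wca_comp : forall T U, A T -> A U -> A (fun f => T (U f));
  wca_closed : forall T, bounded_operator beta T ->
    wot_adherent beta A T -> A T
}.

Definition generated_algebra (beta : nat -> R) (T : operator) : operator -> Prop :=
  fun U => bounded_operator beta U /\
    forall A, weakly_closed_algebra beta A -> A T -> A U.

Definition strictly_cyclic (beta : nat -> R) (T : operator) : Prop :=
  bounded_operator beta T /\
  exists f0, H2 beta f0 /\
    forall g, H2 beta g -> exists U, generated_algebra beta T U /\ U f0 = g.

Definition Mz : operator :=
  fun f k => match k with O => RtoC 0 | S j => f j end.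

(* f |-> (f - f(0)) / z. *)
Definition backward_shift : operator := fun f k => f (S k).

(* V = (z I - T)^{-1} as a bounded operator on H2 beta. *)
Definition is_resolvent (beta : nat -> R) (T : operator) (z : C)
    (V : operator) : Prop :=
  bounded_operator beta V /\
  inverse_on beta (fun f => fsub (fscal z f) (T f)) V.

Definition circle (r theta : R) : C := (r * cos theta, r * sin theta).

(* A = phi(T) = (1 / 2 pi i) * \oint_{|z| = r} phi(z) (z I - T)^{-1} dz, the
   operator-valued integral being taken weakly, with z = r e^{i theta} and
   dz = i z dtheta.  The spectrum of T lies in |z| < r and phi is holomorphic
   on a neighbourhood of |z| <= r; A does not depend on the choice of r. *)
Definition is_holomorphic_calculus (beta : nat -> R) (phi : C -> C)
    (T A : operator) : Prop :=
  bounded_operator beta A /\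
  exists (r r' : R) (Res : C -> operator),
    0 < r < r' /\
    (forall z, r <= Cmod z -> is_resolvent beta T z (Res z)) /\
    (forall z, Cmod z < r' ->
       ex_derive (K := C_AbsRing) (V := C_NormedModule) phi z) /\
    forall f g, H2 beta f -> H2 beta g ->
      is_RInt (V := C_R_NormedModule)
        (fun theta => let z := circle r theta in
           (/ (RtoC (2 * PI) * Ci) *
            (phi z * inner beta (Res z f) g * (Ci * z)))%C)
        0 (2 * PI) (inner beta (A f) g).

Definition mobius (t : R) (z : C) : C :=
  ((RtoC t - z) / (RtoC 1 - RtoC t * z))%C.

(* The bundle with fibre Ker (T - omega I) over omega, given by its fibres. *)
Definition bundle : Type := C -> pseries -> Prop.

Definition kernel_bundle (beta : nat -> R) (T : operator) : bundle :=
  fun omega f => H2 beta f /\ T f = fscal omega f.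

Definition similar (beta : nat -> R) (E1 E2 : bundle) : Prop :=
  exists X, bounded_invertible beta X /\
    forall omega, Cmod omega < 1 ->
      forall g, E2 omega g <-> exists f, E1 omega f /\ X f = g.

(* Main.v *)
(** The kernel of the backward shift S over a real point x is spanned by
    kern x = sum x^k z^k, and phi(S) (kern x) = phi(x) (kern x); hence a
    similarity X satisfies X (kern x) = gamma(x) (kern (phi x)) with
    gamma(x) <> 0.  Row n of the matrix of X therefore holds the Taylor
    coefficients of gamma phi^n, and boundedness of X says that these have norm
    O(beta_n) in H2 beta.  Since beta grows faster than every power, the
    coefficients of gamma phi^n of index k > (1 + d) n carry a negligible part
    of the norm of its derivative, so comparing with the Leibniz rule
    (gamma phi^n)' = n gamma phi' phi^(n-1) + O(1) gives
    ||h phi'|| <= ||h|| in the Hardy space l2 for h = gamma, and likewise for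
    every polynomial multiple h of gamma.  But |phi'| > 1 near z = 1, and
    multiplying by high powers of 1 + z concentrates h there; this forces
    gamma(x) = 0 for some x in (0, 1).  Working with real x and with the real
    and imaginary parts of the matrix separately, only real sequences occur. *)

Require Import Defs.
From Stdlib Require Import Reals Lra Lia Psatz FunctionalExtensionality.
From Coquelicot Require Import Coquelicot.
Open Scope R_scope.

(** * Series and square-summable sequences *)

Lemma ex_series_nonneg_bounded (a : nat -> R) (B : R) :
  (forall k, 0 <= a k) -> (forall n, sum_n a n <= B) ->
  ex_series a /\ Series a <= B.
Proof.
  intros a_ge0 a_le.
  assert (incr : forall n, sum_n a n <= sum_n a (S n)).
  { intro n. rewrite sum_Sn. unfold plus; simpl. specialize (a_ge0 (S n)). lra. }
  destruct (ex_finite_lim_seq_incr (sum_n a) B incr a_le) as [l Hl].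
  assert (Hs : is_series a l) by exact Hl.
  split; [now exists l|].
  rewrite (is_series_unique _ _ Hs).
  assert (L := is_lim_seq_le _ (fun _ => B) l B a_le Hl (is_lim_seq_const B)).
  exact L.
Qed.

Lemma sum_n_le_Series (a : nat -> R) (n : nat) :
  (forall k, 0 <= a k) -> ex_series a -> sum_n a n <= Series a.
Proof.
  intros a_ge0 Ha.
  apply (is_lim_seq_incr_compare (sum_n a)).
  - exact (Series_correct _ Ha).
  - intro m. rewrite sum_Sn. unfold plus; simpl. specialize (a_ge0 (S m)). lra.
Qed.

Lemma Series_nonneg (a : nat -> R) :
  (forall k, 0 <= a k) -> ex_series a -> 0 <= Series a.
Proof.
  intros a_ge0 Ha.
  apply Rle_trans with (sum_n a 0); [rewrite sum_O; apply a_ge0|].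
  now apply sum_n_le_Series.
Qed.

Lemma term_le_Series (a : nat -> R) (k : nat) :
  (forall j, 0 <= a j) -> ex_series a -> a k <= Series a.
Proof.
  intros a_ge0 Ha.
  apply Rle_trans with (sum_n a k); [|now apply sum_n_le_Series].
  destruct k; [rewrite sum_O; lra|].
  rewrite sum_Sn. unfold plus; simpl.
  assert (0 <= sum_n a k); [|lra].
  clear Ha. induction k; [rewrite sum_O; apply a_ge0|].
  rewrite sum_Sn. unfold plus; simpl. specialize (a_ge0 (S k)). lra.
Qed.

Lemma ex_series_dominated (a b : nat -> R) :
  (forall k, Rabs (a k) <= b k) -> ex_series b -> ex_series a.
Proof. intros H Hb. exact (ex_series_le a b H Hb). Qed.

Lemma ex_series_comb (x y : R) (a b : nat -> R) :
  ex_series a -> ex_series b -> ex_series (fun k => x * a k + y * b k).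
Proof.
  intros Ha Hb.
  apply (ex_series_plus (fun k => x * a k) (fun k => y * b k)).
  - exact (ex_series_scal x a Ha).
  - exact (ex_series_scal y b Hb).
Qed.

Lemma Series_comb (x y : R) (a b : nat -> R) :
  ex_series a -> ex_series b ->
  Series (fun k => x * a k + y * b k) = x * Series a + y * Series b.
Proof.
  intros Ha Hb.
  rewrite (Series_plus (fun k => x * a k) (fun k => y * b k)).
  - now rewrite !Series_scal_l.
  - exact (ex_series_scal x a Ha).
  - exact (ex_series_scal y b Hb).
Qed.

Definition l2 (a : nat -> R) : Prop := ex_series (fun k => a k ^ 2).
Definition ip (a b : nat -> R) : R := Series (fun k => a k * b k).
Definition comb (x y : R) (a b : nat -> R) : nat -> R := fun k => x * a k + y * b k.
Definition shift (a : nat -> R) : nat -> R :=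
  fun k => match k with O => 0 | S j => a j end.
(* Multiplication by x + y z on Taylor coefficients. *)
Definition mul1 (x y : R) (a : nat -> R) : nat -> R := comb x y a (shift a).
(* The Euler operator z d/dz. *)
Definition euler (a : nat -> R) : nat -> R := fun k => INR k * a k.

Lemma l2_ex_ip (a b : nat -> R) : l2 a -> l2 b -> ex_series (fun k => a k * b k).
Proof.
  intros Ha Hb.
  apply ex_series_dominated with (fun k => 1 * a k ^ 2 + 1 * b k ^ 2).
  - intro k. apply Rabs_le. split; nra.
  - now apply ex_series_comb.
Qed.

Lemma l2_comb (x y : R) (a b : nat -> R) : l2 a -> l2 b -> l2 (comb x y a b).
Proof.
  intros Ha Hb. unfold l2, comb.
  apply ex_series_dominated with (fun k => (2 * x ^ 2) * a k ^ 2 + (2 * y ^ 2) * b k ^ 2).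
  - intro k. rewrite Rabs_pos_eq by apply pow2_ge_0.
    assert (0 <= (x * a k - y * b k) ^ 2) by apply pow2_ge_0. nra.
  - now apply ex_series_comb.
Qed.

Lemma l2_shift (a : nat -> R) : l2 a -> l2 (shift a).
Proof. intro Ha. unfold l2. apply ex_series_incr_1. exact Ha. Qed.

Lemma l2_mul1 (x y : R) (a : nat -> R) : l2 a -> l2 (mul1 x y a).
Proof. intro Ha. apply l2_comb; [|apply l2_shift]; exact Ha. Qed.

Lemma ip_comm (a b : nat -> R) : ip a b = ip b a.
Proof. apply Series_ext. intro k. ring. Qed.

Lemma ip_comb_l (x y : R) (a b c : nat -> R) :
  l2 a -> l2 b -> l2 c -> ip (comb x y a b) c = x * ip a c + y * ip b c.
Proof.
  intros Ha Hb Hc. unfold ip.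
  rewrite <- Series_comb by now apply l2_ex_ip.
  apply Series_ext. intro k. unfold comb. ring.
Qed.

Lemma ip_comb_r (x y : R) (a b c : nat -> R) :
  l2 a -> l2 b -> l2 c -> ip c (comb x y a b) = x * ip c a + y * ip c b.
Proof.
  intros Ha Hb Hc. rewrite ip_comm, ip_comb_l by assumption.
  now rewrite (ip_comm a), (ip_comm b).
Qed.

Lemma ip_shift (a b : nat -> R) : l2 a -> l2 b -> ip (shift a) (shift b) = ip a b.
Proof.
  intros Ha Hb. unfold ip.
  rewrite Series_incr_1; [simpl; ring|].
  apply l2_ex_ip; now apply l2_shift.
Qed.

Lemma ip_nonneg (a : nat -> R) : l2 a -> 0 <= ip a a.
Proof.
  intro Ha. apply Series_nonneg; [intro k; nra|now apply l2_ex_ip].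
Qed.

Lemma ip_le (a b : nat -> R) : l2 a -> l2 b -> 2 * ip a b <= ip a a + ip b b.
Proof.
  intros Ha Hb.
  assert (Hc : l2 (comb 1 (-1) a b)) by now apply l2_comb.
  assert (H := ip_nonneg _ Hc).
  rewrite ip_comb_l, !ip_comb_r, (ip_comm b a) in H by assumption. lra.
Qed.

Lemma ip_mul1 (x y : R) (a : nat -> R) : l2 a ->
  ip (mul1 x y a) (mul1 x y a) = (x ^ 2 + y ^ 2) * ip a a + 2 * x * y * ip a (shift a).
Proof.
  intro Ha. assert (Hs := l2_shift _ Ha). unfold mul1.
  rewrite ip_comb_l, !ip_comb_r, (ip_comm (shift a) a), ip_shift
    by first [assumption | now apply l2_comb].
  ring.
Qed.

Lemma mul1_comm (x y x' y' : R) (a : nat -> R) :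
  mul1 x y (mul1 x' y' a) = mul1 x' y' (mul1 x y a).
Proof.
  apply functional_extensionality. intros [|[|k]]; unfold mul1, comb; simpl; ring.
Qed.

(** * Multiplication by a Moebius map *)

Section Mobius.

Variable t : R.
Hypothesis ht : 0 < t < 1.

(* In terms of power series: b = phi a, where phi(z) = (t - z) / (1 - t z). *)
Definition phi_mul (a b : nat -> R) : Prop := mul1 1 (- t) b = mul1 t (-1) a.

Fixpoint geom_conv (a : nat -> R) (k : nat) : R :=
  match k with O => a O | S j => t * geom_conv a j + a (S j) end.

Lemma geom_conv_spec (a : nat -> R) : mul1 1 (- t) (geom_conv a) = a.
Proof.
  apply functional_extensionality. intros [|k]; unfold mul1, comb; simpl; ring.
Qed.

Lemma mul1_inj (a b : nat -> R) : mul1 1 (- t) a = mul1 1 (- t) b -> a = b.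
Proof.
  intro H. apply functional_extensionality. intro k.
  assert (Hk : forall j, mul1 1 (- t) a j = mul1 1 (- t) b j) by (intro j; now rewrite H).
  unfold mul1, comb in Hk.
  induction k as [|k IH].
  - specialize (Hk O). simpl in Hk. lra.
  - specialize (Hk (S k)). simpl in Hk. rewrite IH in Hk. lra.
Qed.

Lemma l2_geom_conv (a : nat -> R) : l2 a -> l2 (geom_conv a).
Proof.
  intro Ha. unfold l2.
  set (e := geom_conv a).
  assert (K : forall n, (1 - t) * sum_n (fun k => e k ^ 2) n + t * e n ^ 2
                        <= / (1 - t) * sum_n (fun k => a k ^ 2) n).
  { assert (H1 : 1 <= / (1 - t)).
    { rewrite <- Rinv_1 at 1. apply Rinv_le_contravar; lra. }
    induction n as [|n IH].
    - rewrite !sum_O. unfold e; simpl geom_conv. assert (0 <= a O ^ 2) by apply pow2_ge_0. nra.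
    - rewrite !sum_Sn. unfold plus; simpl Hierarchy.AbelianMonoid.plus.
      change (e (S n)) with (t * e n + a (S n)).
      assert (C : (t * e n + a (S n)) ^ 2 <= t * e n ^ 2 + / (1 - t) * a (S n) ^ 2).
      { assert (E : t * e n ^ 2 + / (1 - t) * a (S n) ^ 2 - (t * e n + a (S n)) ^ 2
                    = t * / (1 - t) * ((1 - t) * e n - a (S n)) ^ 2) by (field; lra).
        assert (0 <= t * / (1 - t) * ((1 - t) * e n - a (S n)) ^ 2); [|lra].
        apply Rmult_le_pos; [apply Rmult_le_pos|apply pow2_ge_0]; lra. }
      simpl in *. lra. }
  apply (ex_series_nonneg_bounded _ (/ (1 - t) * (/ (1 - t) * Series (fun k => a k ^ 2)))).
  - intro k. apply pow2_ge_0.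
  - intro n. specialize (K n).
    assert (P : 0 < / (1 - t)) by (apply Rinv_0_lt_compat; lra).
    assert (S1 := sum_n_le_Series (fun k => a k ^ 2) n (fun k => pow2_ge_0 _) Ha).
    assert (0 <= e n ^ 2) by apply pow2_ge_0.
    apply Rmult_le_reg_l with (1 - t); [lra|].
    rewrite <- Rmult_assoc, Rinv_r, Rmult_1_l by lra.
    apply Rle_trans with (/ (1 - t) * sum_n (fun k => a k ^ 2) n); [nra|].
    apply Rmult_le_compat_l; lra.
Qed.

(* With a = (1 - t z) e one has phi a = (t - z) e, and |t - z| = |1 - t z| on
   the unit circle. *)
Lemma phi_mul_isometry (a b : nat -> R) :
  l2 a -> phi_mul a b -> l2 b /\ ip b b = ip a a.
Proof.
  intros Ha Hab.
  set (e := geom_conv a).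
  assert (He : l2 e) by now apply l2_geom_conv.
  assert (Ea : mul1 1 (- t) e = a) by apply geom_conv_spec.
  assert (Eb : b = mul1 t (-1) e).
  { apply mul1_inj. rewrite Hab, <- Ea. apply mul1_comm. }
  rewrite Eb. split; [now apply l2_mul1|].
  rewrite <- Ea, !ip_mul1 by assumption. ring.
Qed.

Lemma phi_mul_mul1 (x y : R) (a b : nat -> R) :
  phi_mul a b -> phi_mul (mul1 x y a) (mul1 x y b).
Proof.
  unfold phi_mul. intro H.
  now rewrite mul1_comm, H, mul1_comm.
Qed.

(* Leibniz rule: (phi^(n+1) c)' = phi^(n+1) c' + (n+1) phi' phi^n c, where
   (1 - t z)^2 phi' = -(1 - t^2). *)
Lemma phi_mul_euler (F : nat -> nat -> R) (n : nat) :
  phi_mul (F n) (F (S n)) -> phi_mul (F (S n)) (F (S (S n))) ->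
  let f k := mul1 1 (- t) (mul1 1 (- t) (F k)) in
  phi_mul (comb 1 ((INR n + 1) * (1 - t ^ 2)) (euler (f (S n))) (shift (F n)))
          (comb 1 ((INR n + 2) * (1 - t ^ 2)) (euler (f (S (S n)))) (shift (F (S n)))).
Proof.
  intros H1 H2 f.
  assert (H3 : phi_mul (f (S n)) (f (S (S n)))) by now do 2 apply phi_mul_mul1.
  unfold phi_mul in *.
  assert (H1' : forall k, mul1 1 (- t) (F (S n)) k = mul1 t (-1) (F n) k) by (intro; now rewrite H1).
  assert (H2' : forall k, mul1 1 (- t) (F (S (S n))) k = mul1 t (-1) (F (S n)) k) by (intro; now rewrite H2).
  assert (H3' : forall k, mul1 1 (- t) (f (S (S n))) k = mul1 t (-1) (f (S n)) k) by (intro; now rewrite H3).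
  apply functional_extensionality. intro k.
  assert (L : mul1 1 (- t) (euler (f (S (S n)))) k =
          mul1 t (-1) (euler (f (S n))) k - (1 - t ^ 2) * shift (mul1 1 (- t) (F (S n))) k).
  { assert (G2 : f (S (S n)) = mul1 1 (- t) (mul1 t (-1) (F (S n)))) by (unfold f; now rewrite H2).
    destruct k as [|k].
    - unfold mul1, comb, euler; simpl. ring.
    - specialize (H3' (S k)).
      assert (G2k : forall j, f (S (S n)) j = mul1 1 (- t) (mul1 t (-1) (F (S n))) j) by (intro; now rewrite G2).
      assert (E : mul1 1 (- t) (euler (f (S (S n)))) (S k) =
        INR (S k) * mul1 1 (- t) (f (S (S n))) (S k) + t * f (S (S n)) k).
      { unfold mul1, comb, euler. rewrite S_INR. simpl. ring. }
      rewrite E, H3', G2k. unfold f. clear.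
      destruct k as [|[|k]]; unfold mul1, comb, euler; cbn [shift]; rewrite ?S_INR; simpl (INR 0); ring. }
  assert (L2 : shift (mul1 1 (- t) (F (S n))) k = shift (mul1 t (-1) (F n)) k) by now rewrite H1.
  assert (C : forall x y u v a b, mul1 u v (comb x y a b) k = x * mul1 u v a k + y * mul1 u v b k).
  { intros. unfold mul1, comb. destruct k; simpl; ring. }
  assert (C2 : forall u v a, mul1 u v (shift a) k = shift (mul1 u v a) k).
  { intros. unfold mul1, comb. destruct k; simpl; ring. }
  rewrite !C, !C2, L, <- L2. ring.
Qed.

End Mobius.

(** * Superpolynomial growth of the weights *)

Section Growth.

Variable beta : nat -> R.
Hypothesis beta_pos : forall k, 0 < beta k.
Hypothesis growth :
  is_lim_seq (fun k => (INR k + 1) * (weight beta k - 1)) p_infty.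

Lemma pow_chord (x : R) (p : nat) : 0 <= x <= 1 -> (1 + x) ^ p <= 1 + (2 ^ p - 1) * x.
Proof.
  intro Hx. induction p as [|p IH]; [simpl; lra|].
  simpl pow. assert (1 <= 2 ^ p) by (apply pow_R1_Rle; lra).
  assert ((1 + x) * (1 + x) ^ p <= (1 + x) * (1 + (2 ^ p - 1) * x))
    by (apply Rmult_le_compat_l; lra).
  assert (0 <= (2 ^ p - 1) * (x * (1 - x))); [|nra].
  apply Rmult_le_pos; [lra|apply Rmult_le_pos; lra].
Qed.

Lemma beta_growth (p : nat) : exists n0, forall n k, (n0 <= n <= k)%nat ->
  beta n * (INR k + 2) ^ p <= beta k * (INR n + 2) ^ p.
Proof.
  apply is_lim_seq_spec in growth. destruct (growth (2 ^ p)) as [n0 Hn0].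
  exists n0. intros n k [Hn Hk].
  induction Hk as [|k Hk IH]; [lra|].
  assert (W := Hn0 (S k) ltac:(lia)). cbv beta in W. unfold weight in W. simpl pred in W.
  assert (Hb := beta_pos k). assert (K0 := pos_INR k). rewrite S_INR in *.
  replace (INR k + 1 + 1) with (INR k + 2) in W by ring.
  assert (W2 : beta k * (1 + 2 ^ p * / (INR k + 2)) <= beta (S k)).
  { replace (beta (S k)) with (beta k * (1 + (INR k + 2) * (beta (S k) / beta k - 1) * / (INR k + 2)))
      by (field; lra).
    apply Rmult_le_compat_l; [lra|]. apply Rplus_le_compat_l, Rmult_le_compat_r; [|lra].
    left; apply Rinv_0_lt_compat; lra. }
  assert (X : 0 <= / (INR k + 2) <= 1).
  { split; [left; apply Rinv_0_lt_compat; lra|]. rewrite <- Rinv_1. apply Rinv_le_contravar; lra. }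
  assert (C := pow_chord (/ (INR k + 2)) p X).
  replace (INR k + 1 + 2) with ((INR k + 2) * (1 + / (INR k + 2))) by (field; lra).
  rewrite Rpow_mult_distr.
  assert (Hp : 0 < (1 + / (INR k + 2)) ^ p) by (apply pow_lt; lra).
  assert (Hq : 0 < (INR n + 2) ^ p) by (apply pow_lt; assert (N0 := pos_INR n); lra).
  apply Rle_trans with (beta k * (INR n + 2) ^ p * (1 + / (INR k + 2)) ^ p).
  - rewrite <- Rmult_assoc. apply Rmult_le_compat_r; lra.
  - replace (beta k * (INR n + 2) ^ p * (1 + / (INR k + 2)) ^ p)
      with (beta k * (1 + / (INR k + 2)) ^ p * (INR n + 2) ^ p) by ring.
    apply Rmult_le_compat_r; [lra|]. eapply Rle_trans; [|exact W2].
    apply Rmult_le_compat_l; lra.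
Qed.

Lemma beta_lower : exists m, 0 < m /\ forall k, m <= beta k.
Proof.
  destruct (beta_growth 0) as [n0 H].
  assert (F : forall n, exists m, 0 < m /\ forall k, (k <= n)%nat -> m <= beta k).
  { induction n as [|n [m [Hm IH]]].
    - exists (beta O). split; [apply beta_pos|]. intros k Hk. replace k with O by lia. lra.
    - exists (Rmin m (beta (S n))). split; [apply Rmin_glb_lt; auto|].
      intros k Hk. destruct (Nat.eq_dec k (S n)) as [->|Hne]; [apply Rmin_r|].
      eapply Rle_trans; [apply Rmin_l|apply IH; lia]. }
  destruct (F n0) as [m [Hm Hle]]. exists m. split; [exact Hm|]. intro k.
  destruct (Nat.le_gt_cases k n0) as [Hk|Hk]; [now apply Hle|].
  specialize (H n0 k ltac:(lia)). simpl in H.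
  specialize (Hle n0 (Nat.le_refl _)). lra.
Qed.

Definition tempered (F : nat -> nat -> R) : Prop :=
  exists M, forall n, ex_series (fun k => F n k ^ 2 * beta k ^ 2) /\
    Series (fun k => F n k ^ 2 * beta k ^ 2) <= M * beta n ^ 2.

Lemma tempered_l2 (F : nat -> nat -> R) (n : nat) : tempered F -> l2 (F n).
Proof.
  intros [M HM]. destruct (HM n) as [HF _]. destruct beta_lower as [m [Hm Hle]].
  unfold l2. apply ex_series_dominated with (fun k => / m ^ 2 * (F n k ^ 2 * beta k ^ 2)).
  - intro k. rewrite Rabs_pos_eq by apply pow2_ge_0.
    assert (0 < m ^ 2) by now apply pow_lt.
    apply Rmult_le_reg_l with (m ^ 2); [assumption|].
    rewrite <- Rmult_assoc, Rinv_r, Rmult_1_l by lra. rewrite Rmult_comm.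
    apply Rmult_le_compat_l; [apply pow2_ge_0|]. apply pow_incr. split; [lra|apply Hle].
  - exact (ex_series_scal (/ m ^ 2) _ HF).
Qed.

(* The coefficients of F n of index k > (1 + d) n are negligible, because beta
   grows faster than every power. *)
Lemma tempered_euler (F : nat -> nat -> R) (d : R) : tempered F -> 0 < d ->
  exists n0, forall n, (n0 <= n)%nat ->
    l2 (euler (F n)) /\
    ip (euler (F n)) (euler (F n)) <= (INR n + 2) ^ 2 * ((1 + d) ^ 2 * ip (F n) (F n) + d).
Proof.
  intros HF Hd. assert (HF' := HF). destruct HF' as [M HM].
  assert (HM0 : 0 <= M).
  { destruct (HM O) as [E HS].
    assert (0 <= M * beta 0 ^ 2).
    { eapply Rle_trans; [|exact HS]. apply Series_nonneg; [|exact E].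
      intro k. apply Rmult_le_pos; apply pow2_ge_0. }
    assert (0 < beta 0 ^ 2) by apply pow_lt, beta_pos. nra. }
  set (d' := d / (M + 1)).
  assert (Hd' : 0 < d') by (apply Rdiv_lt_0_compat; lra).
  assert (Hp : exists p, / (1 + d) ^ p < d').
  { destruct (pow_lt_1_zero (/ (1 + d))) with d' as [p Hp].
    - rewrite Rabs_pos_eq by (left; apply Rinv_0_lt_compat; lra).
      rewrite <- Rinv_1. apply Rinv_lt_contravar; lra.
    - exact Hd'.
    - exists p. specialize (Hp p (Nat.le_refl _)). rewrite pow_inv in Hp.
      eapply Rle_lt_trans; [apply Rle_abs|exact Hp]. }
  destruct Hp as [p Hp].
  destruct (beta_growth (S p)) as [n0 Hn0]. exists n0. intros n Hn.
  assert (Hl2 := tempered_l2 F n HF). destruct (HM n) as [HE HS].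
  assert (Hbn := beta_pos n). assert (N0 := pos_INR n).
  set (b := fun k => (INR n + 2) ^ 2 * (1 + d) ^ 2 * F n k ^ 2
              + (INR n + 2) ^ 2 * d' * / beta n ^ 2 * (F n k ^ 2 * beta k ^ 2)).
  assert (Hb : ex_series b) by now apply ex_series_comb.
  assert (Hle : forall k, euler (F n) k * euler (F n) k <= b k).
  { intro k. unfold euler, b.
    assert (K0 := pos_INR k). assert (Hbk := beta_pos k).
    replace (INR k * F n k * (INR k * F n k)) with (INR k ^ 2 * F n k ^ 2) by ring.
    replace ((INR n + 2) ^ 2 * (1 + d) ^ 2 * F n k ^ 2
              + (INR n + 2) ^ 2 * d' * / beta n ^ 2 * (F n k ^ 2 * beta k ^ 2))
      with (((INR n + 2) ^ 2 * (1 + d) ^ 2 + (INR n + 2) ^ 2 * d' * (/ beta n ^ 2 * beta k ^ 2)) * F n k ^ 2)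
      by ring.
    apply Rmult_le_compat_r; [apply pow2_ge_0|].
    assert (Hr : 0 < / beta n ^ 2 * beta k ^ 2).
    { apply Rmult_lt_0_compat; [apply Rinv_0_lt_compat|]; now apply pow_lt. }
    assert (HN2 : 0 < (INR n + 2) ^ 2) by (apply pow_lt; lra).
    destruct (Rle_lt_dec (INR k + 2) ((INR n + 2) * (1 + d))) as [Hk|Hk].
    - assert (INR k ^ 2 <= ((INR n + 2) * (1 + d)) ^ 2) by (apply pow_incr; lra).
      assert (0 < (INR n + 2) ^ 2 * d' * (/ beta n ^ 2 * beta k ^ 2)).
      { apply Rmult_lt_0_compat; [apply Rmult_lt_0_compat|]; lra. }
      rewrite <- Rpow_mult_distr. lra.
    - assert (Hnk : (n <= k)%nat) by (apply INR_le; nra).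
      specialize (Hn0 n k ltac:(lia)).
      set (u := INR n + 2) in *. set (v := INR k + 2) in *.
      assert (Hu : 0 < u) by (unfold u; lra). assert (Hv : 0 < v) by (unfold v; lra).
      assert (Huv : 0 < u ^ p) by now apply pow_lt.
      assert (Hvp : (u * (1 + d)) ^ p <= v ^ p).
      { apply pow_incr. split; [apply Rmult_le_pos; lra|lra]. }
      rewrite Rpow_mult_distr in Hvp.
      assert (Hdp : 1 <= d' * (1 + d) ^ p).
      { assert (0 < (1 + d) ^ p) by (apply pow_lt; lra).
        apply Rmult_le_reg_r with (/ (1 + d) ^ p); [now apply Rinv_0_lt_compat|].
        rewrite Rmult_assoc, Rinv_r by lra. lra. }
      assert (Hd1 : 1 <= (1 + d) ^ p) by (apply pow_R1_Rle; lra).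
      simpl pow in Hn0.
      (* (v / u) (1 + d)^p <= (v / u)^(p + 1) <= beta k / beta n *)
      assert (R1 : v * (1 + d) ^ p * beta n <= u * beta k).
      { apply Rmult_le_reg_l with (u ^ p); [assumption|].
        apply Rle_trans with (beta n * (v * v ^ p)); [|lra].
        replace (u ^ p * (v * (1 + d) ^ p * beta n)) with (beta n * (v * (u ^ p * (1 + d) ^ p))) by ring.
        apply Rmult_le_compat_l; [lra|]. apply Rmult_le_compat_l; lra. }
      assert (R2 : (v * (1 + d) ^ p * beta n) ^ 2 <= (u * beta k) ^ 2).
      { apply pow_incr. split; [|assumption].
        apply Rmult_le_pos; [apply Rmult_le_pos|]; lra. }
      rewrite !Rpow_mult_distr in R2.
      assert (R3 : 1 <= d' * ((1 + d) ^ p) ^ 2) by nra.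
      assert (Hkv : INR k ^ 2 <= v ^ 2) by (apply pow_incr; unfold v; lra).
      assert (Hbn2 : 0 < beta n ^ 2) by now apply pow_lt.
      assert (Hv2 : 0 < v ^ 2) by now apply pow_lt.
      assert (R4 : v ^ 2 * beta n ^ 2 <= d' * (u ^ 2 * beta k ^ 2)).
      { apply Rle_trans with (d' * (v ^ 2 * ((1 + d) ^ p) ^ 2 * beta n ^ 2)).
        - replace (d' * (v ^ 2 * ((1 + d) ^ p) ^ 2 * beta n ^ 2))
            with ((d' * ((1 + d) ^ p) ^ 2) * (v ^ 2 * beta n ^ 2)) by ring.
          assert (0 < v ^ 2 * beta n ^ 2) by now apply Rmult_lt_0_compat. nra.
        - apply Rmult_le_compat_l; lra. }
      assert (R5 : v ^ 2 <= u ^ 2 * d' * (/ beta n ^ 2 * beta k ^ 2)).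
      { apply Rmult_le_reg_r with (beta n ^ 2); [assumption|].
        replace (u ^ 2 * d' * (/ beta n ^ 2 * beta k ^ 2) * beta n ^ 2)
          with (d' * (u ^ 2 * beta k ^ 2)) by (field; lra). exact R4. }
      assert (0 <= u ^ 2 * (1 + d) ^ 2) by (apply Rmult_le_pos; apply pow2_ge_0).
      lra. }
  split.
  - unfold l2. apply ex_series_dominated with b; [|exact Hb].
    intro k. rewrite Rabs_pos_eq by apply pow2_ge_0. specialize (Hle k). simpl. lra.
  - apply Rle_trans with (Series b).
    { apply Series_le; [|exact Hb]. intro k. split; [nra|apply Hle]. }
    unfold b. rewrite Series_comb by assumption.
    replace (Series (fun k => F n k ^ 2)) with (ip (F n) (F n))
      by (apply Series_ext; intro; ring).
    assert (Hbn2 : 0 < beta n ^ 2) by now apply pow_lt.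
    assert (HN2 : 0 < (INR n + 2) ^ 2) by (apply pow_lt; lra).
    assert (T : d' * / beta n ^ 2 * Series (fun k => F n k ^ 2 * beta k ^ 2) <= d).
    { apply Rle_trans with (d' * / beta n ^ 2 * (M * beta n ^ 2)).
      - apply Rmult_le_compat_l; [|exact HS].
        apply Rmult_le_pos; [lra|left; now apply Rinv_0_lt_compat].
      - unfold d'. replace (d / (M + 1) * / beta n ^ 2 * (M * beta n ^ 2)) with (d - d / (M + 1)) by (field; lra).
        fold d'. lra. }
    assert (T' := Rmult_le_compat_l _ _ _ (Rlt_le _ _ HN2) T). lra.
Qed.

Hypothesis weight_lim : is_lim_seq (weight beta) 1.

Lemma beta_step : exists C, forall k, beta (S k) <= C * beta k.
Proof.
  destruct (filterlim_bounded (weight beta)) as [C HC].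
  { exists 1. exact weight_lim. }
  exists C. intro k. specialize (HC (S k)). unfold weight in HC. simpl in HC.
  assert (Hb := beta_pos k). assert (H := Rle_abs (beta (S k) / beta k)).
  unfold norm in HC; simpl in HC; unfold abs in HC; simpl in HC.
  replace (beta (S k)) with (beta (S k) / beta k * beta k) by (field; lra).
  apply Rmult_le_compat_r; lra.
Qed.

Lemma tempered_mul1 (x y : R) (F : nat -> nat -> R) :
  tempered F -> tempered (fun n => mul1 x y (F n)).
Proof.
  intros [M HM]. destruct beta_step as [C HC].
  exists (2 * x ^ 2 * M + 2 * y ^ 2 * C ^ 2 * M). intro n.
  destruct (HM n) as [HE HS].
  set (G := fun k => match k with O => 0 | S j => C ^ 2 * (F n j ^ 2 * beta j ^ 2) end).
  assert (HG : ex_series G).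
  { apply ex_series_incr_1. exact (ex_series_scal (C ^ 2) _ HE). }
  assert (HGS : Series G = C ^ 2 * Series (fun k => F n k ^ 2 * beta k ^ 2)).
  { rewrite Series_incr_1 by exact HG. unfold G at 1. rewrite Rplus_0_l.
    apply Series_scal_l. }
  set (b := fun k => 2 * x ^ 2 * (F n k ^ 2 * beta k ^ 2) + 2 * y ^ 2 * G k).
  assert (Hb : ex_series b) by now apply ex_series_comb.
  assert (Hle : forall k, 0 <= mul1 x y (F n) k ^ 2 * beta k ^ 2 <= b k).
  { intro k. split; [apply Rmult_le_pos; apply pow2_ge_0|].
    assert (Hs : shift (F n) k ^ 2 * beta k ^ 2 <= G k).
    { destruct k as [|k]; simpl shift; unfold G; [lra|].
      replace (C ^ 2 * (F n k ^ 2 * beta k ^ 2)) with (F n k ^ 2 * (C * beta k) ^ 2) by ring.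
      apply Rmult_le_compat_l; [apply pow2_ge_0|]. apply pow_incr.
      split; [left; apply beta_pos|apply HC]. }
    unfold b, mul1, comb. set (s := shift (F n) k) in *.
    assert (0 <= (x * F n k - y * s) ^ 2 * beta k ^ 2) by (apply Rmult_le_pos; apply pow2_ge_0).
    assert (2 * y ^ 2 * (s ^ 2 * beta k ^ 2) <= 2 * y ^ 2 * G k).
    { apply Rmult_le_compat_l; [|exact Hs]. assert (0 <= y ^ 2) by apply pow2_ge_0. lra. }
    nra. }
  split.
  - apply ex_series_dominated with b; [|exact Hb].
    intro k. rewrite Rabs_pos_eq by apply Hle. apply Hle.
  - apply Rle_trans with (Series b); [now apply Series_le|].
    unfold b. rewrite Series_comb by assumption. rewrite HGS.
    assert (0 <= x ^ 2) by apply pow2_ge_0. assert (0 <= y ^ 2) by apply pow2_ge_0.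
    assert (0 <= C ^ 2) by apply pow2_ge_0.
    assert (0 <= y ^ 2 * C ^ 2) by now apply Rmult_le_pos.
    set (s := Series _) in *.
    assert (2 * x ^ 2 * s <= 2 * x ^ 2 * (M * beta n ^ 2)) by (apply Rmult_le_compat_l; lra).
    assert (2 * (y ^ 2 * C ^ 2) * s <= 2 * (y ^ 2 * C ^ 2) * (M * beta n ^ 2)) by (apply Rmult_le_compat_l; lra).
    lra.
Qed.

End Growth.

(** * The contraction estimate and its consequence *)

Section Core.

Variable beta : nat -> R.
Hypothesis beta_pos : forall k, 0 < beta k.
Hypothesis growth :
  is_lim_seq (fun k => (INR k + 1) * (weight beta k - 1)) p_infty.
Variable t : R.
Hypothesis ht : 0 < t < 1.

(* Such a family has the form F n = phi^n c with c = F 0. *)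
Definition phi_family (F : nat -> nat -> R) : Prop :=
  forall n, phi_mul t (F n) (F (S n)).

Lemma phi_family_ip (F : nat -> nat -> R) (n : nat) :
  phi_family F -> l2 (F O) -> l2 (F n) /\ ip (F n) (F n) = ip (F O) (F O).
Proof.
  intros HF H0. induction n as [|n [IH1 IH2]]; [now split|].
  destruct (phi_mul_isometry t ht _ _ IH1 (HF n)) as [Ha Hb].
  split; [exact Ha|now rewrite Hb].
Qed.

(* ||phi' h|| <= ||h|| for h = (1 - t z)^2 c: the family phi^n h has Euler
   derivatives of size n ||phi' h|| + O(1), and by temperedness at most
   (1 + o(1)) n ||h||. *)
Lemma tempered_phi_derivative (F : nat -> nat -> R) :
  tempered beta F -> tempered beta (fun n => mul1 1 (- t) (mul1 1 (- t) (F n))) ->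
  phi_family F ->
  let h := mul1 1 (- t) (mul1 1 (- t) (F O)) in
  (1 - t ^ 2) ^ 2 * ip (F O) (F O) <= ip h h.
Proof.
  intros HF Hf Hphi h.
  set (f := fun n => mul1 1 (- t) (mul1 1 (- t) (F n))) in *.
  assert (l2F := fun n => tempered_l2 beta beta_pos growth F n HF).
  assert (l2f := fun n => tempered_l2 beta beta_pos growth f n Hf).
  assert (ipF := fun n => proj2 (phi_family_ip F n Hphi (l2F O))).
  assert (fphi : phi_family f) by (intro n; now do 2 apply phi_mul_mul1).
  assert (ipf := fun n => proj2 (phi_family_ip f n fphi (l2f O))).
  set (A := ip (F O) (F O)) in *. set (H := ip h h).
  change (forall n, ip (f n) (f n) = H) in ipf.
  assert (HA : 0 <= A) by now apply ip_nonneg.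
  assert (HH : 0 <= H) by exact (ip_nonneg _ (l2f O)).
  assert (Ht2 : 0 < 1 - t ^ 2) by nra.
  assert (key : forall d, 0 < d < 1 ->
    (1 - t ^ 2) ^ 2 * A <= (1 + d) ^ 2 * ((1 + d) ^ 2 * H + d) + d).
  { intros d Hd.
    destruct (tempered_euler beta beta_pos growth f d Hf (proj1 Hd)) as [n0 Hn0].
    set (W := fun n => comb 1 ((INR n + 1) * (1 - t ^ 2)) (euler (f (S n))) (shift (F n))).
    assert (HW : forall n, phi_mul t (W n) (W (S n))).
    { intro n. assert (E := phi_mul_euler t F n (Hphi n) (Hphi (S n))).
      cbv zeta in E. unfold W. rewrite S_INR.
      replace (INR n + 1 + 1) with (INR n + 2) by ring. exact E. }
    assert (l2W : forall n, (n0 <= n)%nat -> l2 (W n)).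
    { intros n Hn. apply l2_comb; [apply Hn0; lia|apply l2_shift, l2F]. }
    assert (ipW : forall j, ip (W (n0 + j)%nat) (W (n0 + j)%nat) = ip (W n0) (W n0)).
    { induction j as [|j IH]; [now rewrite Nat.add_0_r|].
      rewrite Nat.add_succ_r, <- IH.
      apply (phi_mul_isometry t ht _ _ (l2W (n0 + j)%nat ltac:(lia)) (HW _)). }
    set (B := ip (W n0) (W n0)) in *.
    assert (HB : 0 <= B) by now apply ip_nonneg, l2W.
    assert (est : forall j, (INR (n0 + j) + 1) ^ 2 * ((1 - t ^ 2) ^ 2 * A) <=
      (1 + / d) * B + (1 + d) * ((INR (n0 + j) + 3) ^ 2 * ((1 + d) ^ 2 * H + d))).
    { intro j. set (n := (n0 + j)%nat).
      destruct (Hn0 (S n) ltac:(unfold n; lia)) as [l2D ipD].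
      rewrite ipf, S_INR in ipD. replace (INR n + 1 + 2) with (INR n + 3) in ipD by ring.
      assert (lW := l2W n ltac:(unfold n; lia)).
      set (D := euler (f (S n))) in *.
      assert (E1 : comb 1 (-1) (W n) D = comb ((INR n + 1) * (1 - t ^ 2)) 0 (shift (F n)) D).
      { apply functional_extensionality. intro k. unfold W, comb. fold D. ring. }
      assert (lS := l2_shift _ (l2F n)).
      assert (E2 : ip (comb 1 (-1) (W n) D) (comb 1 (-1) (W n) D) =
                   (INR n + 1) ^ 2 * ((1 - t ^ 2) ^ 2 * A)).
      { rewrite E1, ip_comb_l, !ip_comb_r by first [assumption | now apply l2_comb].
        rewrite ip_shift, ipF by apply l2F. ring. }
      assert (HY : ip (W n) (W n) = B) by apply ipW.
      rewrite ip_comb_l, !ip_comb_r, (ip_comm D (W n)), HY in E2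
        by first [assumption | now apply l2_comb].
      assert (lC : l2 (comb 1 d (W n) D)) by now apply l2_comb.
      assert (P := ip_nonneg _ lC).
      rewrite ip_comb_l, !ip_comb_r, (ip_comm D (W n)), HY in P by assumption.
      rewrite <- E2.
      apply Rle_trans with ((1 + / d) * B + (1 + d) * ip D D).
      - assert (Q : 0 <= / d * (B + 2 * d * ip (W n) D + d ^ 2 * ip D D)).
        { apply Rmult_le_pos; [left; apply Rinv_0_lt_compat; lra|lra]. }
        replace (/ d * (B + 2 * d * ip (W n) D + d ^ 2 * ip D D))
          with (/ d * B + 2 * ip (W n) D + d * ip D D) in Q by (field; lra).
        lra.
      - apply Rplus_le_compat_l, Rmult_le_compat_l; lra. }
    destruct (INR_unbounded (8 / d + (1 + / d) * B / d)) as [j Hj].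
    specialize (est j).
    assert (X8 : 0 < 8 / d) by (apply Rdiv_lt_0_compat; lra).
    assert (Hinv : 0 < / d) by (apply Rinv_0_lt_compat; lra).
    assert (HB2 : 0 <= (1 + / d) * B) by (apply Rmult_le_pos; lra).
    assert (XB : 0 <= (1 + / d) * B / d) by (apply Rmult_le_pos; lra).
    assert (Xj : INR j <= INR (n0 + j)) by (apply le_INR; lia).
    set (X := INR (n0 + j) + 1) in *.
    replace (INR (n0 + j) + 3) with (X + 2) in est by (unfold X; ring).
    assert (X1 : 8 <= d * X).
    { replace 8 with (d * (8 / d)) by (field; lra).
      apply Rmult_le_compat_l; unfold X; lra. }
    assert (X2 : (1 + / d) * B <= d * X).
    { replace ((1 + / d) * B) with (d * ((1 + / d) * B / d)) at 1 by (field; lra).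
      apply Rmult_le_compat_l; unfold X; lra. }
    assert (X3 : 8 < X) by nra.
    assert (X4 : (1 + / d) * B <= d * X ^ 2) by nra.
    assert (X5 : (X + 2) ^ 2 <= (1 + d) * X ^ 2) by nra.
    set (G := (1 + d) ^ 2 * H + d) in *.
    assert (HG : 0 <= G) by (unfold G; assert (0 <= (1 + d) ^ 2 * H) by (apply Rmult_le_pos; [apply pow2_ge_0|lra]); lra).
    assert (X6 : (X + 2) ^ 2 * G <= (1 + d) * X ^ 2 * G) by (apply Rmult_le_compat_r; lra).
    assert (X7 : (1 + d) * ((X + 2) ^ 2 * G) <= (1 + d) * ((1 + d) * X ^ 2 * G)) by (apply Rmult_le_compat_l; lra).
    apply Rmult_le_reg_l with (X ^ 2); [nra|]. nra. }
  apply le_epsilon. intros eps Heps.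
  set (d := Rmin (/ 2) (eps / (15 * H + 5))).
  assert (Hq : 0 < eps / (15 * H + 5)) by (apply Rdiv_lt_0_compat; lra).
  assert (Hd : 0 < d < 1).
  { split; [apply Rmin_glb_lt; lra|]. assert (K := Rmin_l (/ 2) (eps / (15 * H + 5))). fold d in K. lra. }
  assert (Hd2 : d * (15 * H + 5) <= eps).
  { replace eps with (eps / (15 * H + 5) * (15 * H + 5)) by (field; lra).
    apply Rmult_le_compat_r; [lra|apply Rmin_r]. }
  specialize (key d Hd).
  assert (P1 : (1 + d) ^ 2 <= 1 + 3 * d) by nra.
  assert (P0 : 0 <= (1 + d) ^ 2) by apply pow2_ge_0.
  assert (P2 : (1 + d) ^ 2 * (1 + d) ^ 2 <= 1 + 15 * d) by nra.
  assert (P3 : (1 + d) ^ 2 * (1 + d) ^ 2 * H <= (1 + 15 * d) * H) by (apply Rmult_le_compat_r; lra).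
  assert (P4 : (1 + d) ^ 2 * d <= 4 * d) by (apply Rmult_le_compat_r; lra).
  lra.
Qed.

Hypothesis weight_lim : is_lim_seq (weight beta) 1.

(* |1 - t z|^4 <= (1 + t^2)^2 + 4 t^2 - 4 t (1 + t^2) Re z on the unit circle. *)
Lemma tempered_phi_correlation (F : nat -> nat -> R) :
  tempered beta F -> phi_family F ->
  ip (F O) (shift (F O)) <= 2 * t / (1 + t ^ 2) * ip (F O) (F O).
Proof.
  intros HF Hphi.
  assert (Hf : tempered beta (fun n => mul1 1 (- t) (mul1 1 (- t) (F n)))).
  { apply (tempered_mul1 beta beta_pos weight_lim 1 (- t) (fun n => mul1 1 (- t) (F n))).
    now apply tempered_mul1. }
  assert (K := tempered_phi_derivative F HF Hf Hphi). cbv zeta in K.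
  assert (lc := tempered_l2 beta beta_pos growth F O HF).
  set (c := F O) in *.
  assert (ls := l2_shift _ lc). assert (lss := l2_shift _ ls).
  rewrite (ip_mul1 _ _ (mul1 1 (- t) c)), (ip_mul1 _ _ c) in K
    by first [assumption | now apply l2_mul1].
  assert (E : shift (mul1 1 (- t) c) = comb 1 (- t) (shift c) (shift (shift c))).
  { apply functional_extensionality. intros [|k]; unfold mul1, comb; simpl; ring. }
  rewrite E in K. unfold mul1 in K.
  rewrite ip_comb_l, !ip_comb_r, !ip_shift in K by first [assumption | now apply l2_comb].
  assert (C := ip_le c (shift (shift c)) lc lss). rewrite !ip_shift in C by assumption.
  set (N := ip c c) in *. set (r := ip c (shift c)) in *. set (s := ip c (shift (shift c))) in *.
  apply Rmult_le_reg_l with (4 * t * (1 + t ^ 2)); [nra|].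
  replace (4 * t * (1 + t ^ 2) * (2 * t / (1 + t ^ 2) * N)) with (8 * t ^ 2 * N) by (field; nra).
  assert (2 * t ^ 2 * s <= 2 * t ^ 2 * N) by (apply Rmult_le_compat_l; nra).
  nra.
Qed.

Lemma l2_PSeries_bound (a : nat -> R) (x s : R) : l2 a -> Rabs x < 1 -> 0 < s ->
  2 * Rabs (PSeries a x) <= s * ip a a + / s * / (1 - x ^ 2).
Proof.
  intros Ha Hx Hs.
  assert (Hx2 : Rabs (x ^ 2) < 1).
  { rewrite <- RPow_abs. assert (0 <= Rabs x) by apply Rabs_pos. simpl. nra. }
  assert (Hg := ex_series_geom _ Hx2).
  assert (is := Rinv_0_lt_compat _ Hs).
  set (b := fun k => s / 2 * a k ^ 2 + / s / 2 * (x ^ 2) ^ k).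
  assert (Hb : ex_series b) by now apply ex_series_comb.
  assert (Hle : forall k, Rabs (a k * x ^ k) <= b k).
  { intro k. unfold b. rewrite <- pow_mult, Nat.mul_comm, pow_mult.
    set (u := a k). set (v := x ^ k).
    apply Rmult_le_reg_l with (2 * s); [lra|].
    replace (2 * s * (s / 2 * u ^ 2 + / s / 2 * v ^ 2)) with ((s * u) ^ 2 + v ^ 2) by (field; lra).
    replace (2 * s * Rabs (u * v)) with (2 * Rabs (s * u * v))
      by (rewrite (Rabs_mult (s * u)), (Rabs_mult s), (Rabs_mult u), (Rabs_pos_eq s) by lra; ring).
    unfold Rabs. destruct (Rcase_abs (s * u * v)).
    - assert (0 <= (s * u + v) ^ 2) by apply pow2_ge_0. lra.
    - assert (0 <= (s * u - v) ^ 2) by apply pow2_ge_0. lra. }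
  assert (Habs : ex_series (fun k => Rabs (a k * x ^ k))).
  { apply ex_series_dominated with b; [|exact Hb]. intro k. now rewrite Rabs_Rabsolu. }
  assert (Rabs (PSeries a x) <= Series b).
  { unfold PSeries. eapply Rle_trans; [apply Series_Rabs; exact Habs|].
    apply Series_le; [|exact Hb]. intro k. split; [apply Rabs_pos|apply Hle]. }
  assert (E : Series b = s / 2 * ip a a + / s / 2 * / (1 - x ^ 2)).
  { unfold b. rewrite Series_comb, Series_geom by assumption.
    f_equal. f_equal. apply Series_ext. intro; ring. }
  lra.
Qed.

Lemma l2_ex_pseries (a : nat -> R) (x : R) : l2 a -> Rabs x < 1 ->
  ex_series (fun k => a k * x ^ k).
Proof.
  intros Ha Hx. apply l2_ex_ip; [exact Ha|]. unfold l2.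
  apply ex_series_ext with (fun k => (x ^ 2) ^ k).
  { intro k. now rewrite <- !pow_mult, Nat.mul_comm. }
  apply ex_series_geom.
  rewrite <- RPow_abs. assert (0 <= Rabs x) by apply Rabs_pos. simpl. nra.
Qed.

Lemma PSeries_mul1 (a : nat -> R) (u v x : R) : l2 a -> Rabs x < 1 ->
  PSeries (mul1 u v a) x = (u + v * x) * PSeries a x.
Proof.
  intros Ha Hx. unfold PSeries.
  assert (H1 := l2_ex_pseries _ _ Ha Hx).
  assert (H2 := l2_ex_pseries _ _ (l2_shift _ Ha) Hx).
  rewrite (Series_ext _ (fun k => u * (a k * x ^ k) + v * (shift a k * x ^ k)))
    by (intro k; unfold mul1, comb; ring).
  rewrite Series_comb by assumption.
  rewrite (Series_incr_1 (fun k => shift a k * x ^ k)) by assumption. simpl shift.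
  rewrite (Series_ext (fun k => a k * x ^ S k) (fun k => x * (a k * x ^ k))) by (intro; simpl; ring).
  rewrite Series_scal_l. ring.
Qed.

(* Repeated multiplication by 1 + z, whose modulus is maximal at z = 1, where
   |phi'| > 1: the correlation bound makes ||(1 + z)^m c|| grow at rate less
   than 2^m, while at x close to 1 it grows like (1 + x)^m. *)
Lemma tempered_phi_vanish : exists x, 0 < x < 1 /\
  forall F, tempered beta F -> phi_family F -> PSeries (F O) x = 0.
Proof.
  set (q := 2 * t / (1 + t ^ 2)).
  assert (Hq : 0 < q < 1).
  { unfold q. split; [apply Rdiv_lt_0_compat; nra|].
    apply Rmult_lt_reg_r with (1 + t ^ 2); [nra|].
    replace (2 * t / (1 + t ^ 2) * (1 + t ^ 2)) with (2 * t) by (field; nra). nra. }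
  set (rho := sqrt (2 + 2 * q)).
  assert (Hrho2 : rho * rho = 2 + 2 * q) by (apply sqrt_sqrt; lra).
  assert (Hrho : 0 < rho) by (apply sqrt_lt_R0; lra).
  assert (Hrho' : rho < 2) by nra.
  exists (rho / 2). split; [lra|]. intros F HF Hphi.
  set (x := rho / 2). assert (Hx : Rabs x < 1) by (rewrite Rabs_pos_eq; unfold x; lra).
  set (G := fun m => Nat.iter m (fun (F : nat -> nat -> R) n => mul1 1 1 (F n)) F).
  assert (HG : forall m, tempered beta (G m) /\ phi_family (G m)).
  { induction m as [|m [IH1 IH2]]; [now split|]. split.
    - exact (tempered_mul1 beta beta_pos weight_lim 1 1 _ IH1).
    - intro n. exact (phi_mul_mul1 t 1 1 _ _ (IH2 n)). }
  assert (l2G : forall m, l2 (G m O)).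
  { intro m. apply (tempered_l2 beta beta_pos growth). apply HG. }
  assert (norm_G : forall m, ip (G m O) (G m O) <= rho ^ m * rho ^ m * ip (F O) (F O)).
  { induction m as [|m IH]; [simpl; lra|].
    change (G (S m) O) with (mul1 1 1 (G m O)). rewrite ip_mul1 by apply l2G.
    assert (C := tempered_phi_correlation (G m) (proj1 (HG m)) (proj2 (HG m))). fold q in C.
    replace (rho ^ S m * rho ^ S m * ip (F O) (F O))
      with ((rho * rho) * (rho ^ m * rho ^ m * ip (F O) (F O))) by (simpl; ring).
    rewrite Hrho2. nra. }
  assert (eval_G : forall m, PSeries (G m O) x = (1 + x) ^ m * PSeries (F O) x).
  { induction m as [|m IH]; [simpl; ring|].
    change (G (S m) O) with (mul1 1 1 (G m O)).
    rewrite PSeries_mul1, IH by auto. simpl. ring. }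
  destruct (Req_dec (PSeries (F O) x) 0) as [|Hne]; [assumption|exfalso].
  set (v := Rabs (PSeries (F O) x)).
  assert (Hv : 0 < v) by now apply Rabs_pos_lt.
  set (B := ip (F O) (F O) + / (1 - x ^ 2)).
  set (u := (1 + x) / rho).
  assert (Hu : 1 < u).
  { unfold u. apply Rmult_lt_reg_r with rho; [lra|].
    replace ((1 + x) / rho * rho) with (1 + x) by (field; lra). unfold x. lra. }
  assert (bound : forall m, 2 * (u ^ m * v) <= B).
  { intro m. assert (Hr : 0 < rho ^ m) by now apply pow_lt.
    assert (P := l2_PSeries_bound (G m O) x (/ rho ^ m) (l2G m) Hx (Rinv_0_lt_compat _ Hr)).
    rewrite eval_G, Rabs_mult, (Rabs_pos_eq ((1 + x) ^ m)), Rinv_inv in P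
      by (apply pow_le; unfold x; lra).
    fold v in P.
    assert (Q : / rho ^ m * ip (G m O) (G m O) <= rho ^ m * ip (F O) (F O)).
    { apply Rmult_le_reg_l with (rho ^ m); [assumption|].
      rewrite <- Rmult_assoc, Rinv_r, Rmult_1_l by lra.
      specialize (norm_G m). lra. }
    unfold u, Rdiv. rewrite Rpow_mult_distr, pow_inv.
    apply Rmult_le_reg_l with (rho ^ m); [assumption|].
    replace (rho ^ m * (2 * ((1 + x) ^ m * / rho ^ m * v))) with (2 * ((1 + x) ^ m * v))
      by (field; lra).
    unfold B. lra. }
  destruct (Pow_x_infinity u) with (b := B / v) as [m Hm].
  { rewrite Rabs_pos_eq; lra. }
  specialize (Hm m (Nat.le_refl _)). specialize (bound m).
  assert (Hum : 0 < u ^ m) by (apply pow_lt; lra).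
  rewrite Rabs_pos_eq in Hm by lra.
  assert (B <= u ^ m * v).
  { apply Rge_le in Hm. apply Rmult_le_compat_r with (r := v) in Hm; [|lra].
    replace (B / v * v) with B in Hm by (field; lra). exact Hm. }
  assert (0 < u ^ m * v) by now apply Rmult_lt_0_compat. lra.
Qed.

End Core.

(** * Poisson integrals *)

Lemma one_minus_cos_pos (a th : R) : Rabs a < 1 -> 0 < 1 - a * cos th.
Proof.
  intro Ha. assert (C : Rabs (cos th) <= 1) by apply Rabs_le, COS_bound.
  assert (H := Rle_abs (a * cos th)). rewrite Rabs_mult in H.
  assert (0 <= Rabs a) by apply Rabs_pos. nra.
Qed.

Lemma poisson_den_pos (a th : R) : Rabs a < 1 -> 0 < 1 - 2 * a * cos th + a ^ 2.
Proof.
  intro Ha. assert (C := COS_bound th). assert (H := one_minus_cos_pos a th Ha).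
  assert (0 < (1 - a * cos th) ^ 2) by now apply pow_lt.
  assert (0 <= a ^ 2 * (1 - cos th ^ 2)) by (apply Rmult_le_pos; [apply pow2_ge_0|nra]).
  lra.
Qed.

(* [- atan (a sin / (1 - a cos))] is the argument of 1 - a e^(i theta). *)
Lemma is_RInt_poisson_re (a : R) : Rabs a < 1 ->
  is_RInt (fun th => (1 - a * cos th) / (1 - 2 * a * cos th + a ^ 2)) 0 (2 * PI) (2 * PI).
Proof.
  intro Ha.
  set (G := fun th => th + atan (a * sin th / (1 - a * cos th))).
  replace (2 * PI) with (minus (G (2 * PI)) (G 0)) at 2.
  - apply (is_RInt_derive (V := R_CompleteNormedModule) G).
    + intros th _. unfold G.
      assert (H1 := one_minus_cos_pos a th Ha). assert (H2 := poisson_den_pos a th Ha).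
      auto_derive; [lra|].
      assert (H3 : sin th * sin th + cos th * cos th = 1) by (assert (E := sin2_cos2 th); unfold Rsqr in E; exact E).
      assert (H4 : 1 + (a * sin th / (1 - a * cos th)) ^ 2 = (1 - 2 * a * cos th + a ^ 2) / (1 - a * cos th) ^ 2).
      { assert (E : sin th ^ 2 = 1 - cos th ^ 2) by lra.
        apply Rmult_eq_reg_r with ((1 - a * cos th) ^ 2); [|apply pow_nonzero; lra].
        transitivity ((1 - a * cos th) ^ 2 + a ^ 2 * sin th ^ 2); [field; lra|].
        rewrite E. field. lra. }
      transitivity (1 + (a * cos th * (1 - a * cos th) - a ^ 2 * sin th ^ 2) / (1 - a * cos th) ^ 2
                        / (1 + (a * sin th / (1 - a * cos th)) ^ 2)).
      { unfold Rminus, Rdiv. f_equal. f_equal. field. lra. }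
      rewrite H4. replace (sin th ^ 2) with (1 - cos th ^ 2) by lra.
      field. split; lra.
    + intros th _. apply (ex_derive_continuous (V := R_NormedModule)).
      assert (H2 := poisson_den_pos a th Ha).
      auto_derive. lra.
  - unfold G. rewrite sin_2PI, cos_2PI, sin_0, cos_0. unfold minus, plus, opp; simpl. ring.
Qed.

Lemma is_RInt_poisson_im (a : R) : Rabs a < 1 ->
  is_RInt (fun th => a * sin th / (1 - 2 * a * cos th + a ^ 2)) 0 (2 * PI) 0.
Proof.
  intro Ha.
  set (G := fun th => / 2 * ln (1 - 2 * a * cos th + a ^ 2)).
  replace 0 with (minus (G (2 * PI)) (G 0)) at 2.
  - apply (is_RInt_derive (V := R_CompleteNormedModule) G).
    + intros th _. unfold G.
      assert (H2 := poisson_den_pos a th Ha).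
      auto_derive; [simpl in *; lra|]. field. simpl in *; lra.
    + intros th _. apply (ex_derive_continuous (V := R_NormedModule)).
      assert (H2 := poisson_den_pos a th Ha).
      auto_derive. simpl in *; lra.
  - unfold G. rewrite cos_2PI, cos_0. unfold minus, plus, opp; simpl. ring.
Qed.

(** * Bounded functionals on the weighted Hardy space *)

Lemma is_series_finite (a : nat -> R) (J : nat) :
  (forall k, (J < k)%nat -> a k = 0) -> is_series a (sum_n a J).
Proof.
  intro Ha. apply (filterlim_ext_loc (fun _ => sum_n a J)); [|apply filterlim_const].
  exists J. intros n Hn. induction Hn as [|n Hn IH]; [reflexivity|].
  rewrite sum_Sn, (Ha (S n)), <- IH by lia. symmetry. apply Rplus_0_r.
Qed.

Lemma Series_single (a : nat -> R) (j : nat) :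
  (forall k, k <> j -> a k = 0) -> Series a = a j.
Proof.
  intro Ha. apply is_series_unique.
  replace (a j) with (sum_n a j); [apply is_series_finite; intros; apply Ha; lia|].
  destruct j as [|j]; [apply sum_O|].
  rewrite sum_Sn, (sum_n_ext_loc a (fun _ => 0)), sum_n_const by (intros; apply Ha; lia).
  rewrite Rmult_0_r. apply Rplus_0_l.
Qed.

Definition basis (j : nat) : pseries := fun k => if Nat.eqb k j then RtoC 1 else RtoC 0.

Definition kern (x : R) : pseries := fun k => RtoC (x ^ k).

Definition trunc (J : nat) (v : nat -> R) : pseries :=
  fun k => if Nat.leb k J then RtoC (v k) else RtoC 0.

Definition tail (J : nat) (v : nat -> R) : pseries :=
  fun k => if Nat.leb k J then RtoC 0 else RtoC (v k).

Lemma Cmod_RtoC_sq (x : R) : Cmod (RtoC x) ^ 2 = x ^ 2.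
Proof. rewrite Cmod_R. apply pow2_abs. Qed.

(* [sum_n_ext] and friends leave equations in an abstract module structure on R. *)
Ltac eq_in_R := match goal with |- ?a = ?b => change (@eq R a b) end.

Section RowVectors.

Variable alpha : nat -> R.
Hypothesis alpha_pos : forall k, 0 < alpha k.

Lemma is_series_trunc (J : nat) (v : nat -> R) :
  is_series (fun k => Cmod (trunc J v k) ^ 2 * alpha k ^ 2)
            (sum_n (fun k => v k ^ 2 * alpha k ^ 2) J).
Proof.
  rewrite (sum_n_ext_loc _ (fun k => Cmod (trunc J v k) ^ 2 * alpha k ^ 2)).
  - apply is_series_finite. intros k Hk. unfold trunc.
    rewrite (proj2 (Nat.leb_gt k J)) by lia. rewrite Cmod_RtoC_sq. ring.
  - intros k Hk. unfold trunc. rewrite (proj2 (Nat.leb_le k J)) by lia.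
    now rewrite Cmod_RtoC_sq.
Qed.

Lemma H2_trunc (J : nat) (v : nat -> R) : H2 alpha (trunc J v).
Proof. eexists. apply is_series_trunc. Qed.

Lemma H2_basis (j : nat) : H2 alpha (basis j).
Proof.
  eexists. apply (is_series_finite _ j). intros k Hk. unfold basis.
  rewrite (proj2 (Nat.eqb_neq k j)) by lia. rewrite Cmod_RtoC_sq. ring.
Qed.

Lemma H2_fscal (c : C) (f : pseries) : H2 alpha f -> H2 alpha (fscal c f).
Proof.
  intro Hf. apply ex_series_ext with (fun k => Cmod c ^ 2 * (Cmod (f k) ^ 2 * alpha k ^ 2)).
  - intro k. unfold fscal. rewrite Cmod_mult, Rpow_mult_distr. symmetry. apply Rmult_assoc.
  - exact (ex_series_scal (Cmod c ^ 2) _ Hf).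
Qed.

Lemma Cmod_coef_le (f : pseries) (k : nat) :
  H2 alpha f -> Cmod (f k) <= / alpha k * H2norm alpha f.
Proof.
  intro Hf. assert (Ha := alpha_pos k).
  apply Rmult_le_reg_l with (alpha k); [assumption|].
  rewrite <- Rmult_assoc, Rinv_r, Rmult_1_l by lra.
  rewrite <- (sqrt_pow2 (alpha k * Cmod (f k)))
    by (apply Rmult_le_pos; [lra|apply Cmod_ge_0]).
  unfold H2norm.
  apply sqrt_le_1_alt.
  replace ((alpha k * Cmod (f k)) ^ 2) with (Cmod (f k) ^ 2 * alpha k ^ 2) by ring.
  apply (term_le_Series (fun k => Cmod (f k) ^ 2 * alpha k ^ 2)); [|exact Hf].
  intro j. apply Rmult_le_pos; apply pow2_ge_0.
Qed.

Variable l : pseries -> R.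
Variable B : R.
Hypothesis l_add : forall f g, H2 alpha f -> H2 alpha g -> l (fadd f g) = l f + l g.
Hypothesis l_scal : forall c f, H2 alpha f -> l (fscal (RtoC c) f) = c * l f.
Hypothesis l_bound : forall f, H2 alpha f -> Rabs (l f) <= B * H2norm alpha f.

Lemma functional_trunc (J : nat) (v : nat -> R) :
  l (trunc J v) = sum_n (fun j => v j * l (basis j)) J.
Proof.
  induction J as [|J IH].
  - rewrite sum_O, <- l_scal by apply H2_basis. f_equal.
    apply functional_extensionality. intros [|k]; unfold trunc, fscal, basis; simpl; ring.
  - rewrite sum_Sn, <- IH, <- l_scal by apply H2_basis.
    unfold plus; simpl Hierarchy.AbelianMonoid.plus.
    transitivity (l (fadd (trunc J v) (fscal (RtoC (v (S J))) (basis (S J)))));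
      [|apply l_add; [apply H2_trunc|apply H2_fscal, H2_basis]].
    f_equal. apply functional_extensionality. intro k.
    unfold trunc, fadd, fscal, basis.
    destruct (Nat.leb_spec k (S J)), (Nat.leb_spec k J), (Nat.eqb_spec k (S J)); subst;
      try lia; try ring.
Qed.

(* Duality: test the functional on the truncations of its own coefficients. *)
Lemma functional_coef_norm :
  ex_series (fun j => l (basis j) ^ 2 * (/ alpha j) ^ 2) /\
  Series (fun j => l (basis j) ^ 2 * (/ alpha j) ^ 2) <= B ^ 2.
Proof.
  apply ex_series_nonneg_bounded.
  { intro k. apply Rmult_le_pos; apply pow2_ge_0. }
  intro J. set (s := sum_n _ J).
  set (v := fun j => l (basis j) * (/ alpha j) ^ 2).
  assert (E1 : l (trunc J v) = s).
  { rewrite functional_trunc. apply sum_n_ext. intro j. eq_in_R. unfold v. ring. }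
  assert (E2 : Series (fun k => Cmod (trunc J v k) ^ 2 * alpha k ^ 2) = s).
  { rewrite (is_series_unique _ _ (is_series_trunc J v)). apply sum_n_ext. intro j.
    assert (H := alpha_pos j). eq_in_R. unfold v. field. lra. }
  assert (Hb := l_bound _ (H2_trunc J v)). unfold H2norm in Hb. rewrite E1, E2 in Hb.
  assert (Hs := Rle_trans _ _ _ (Rle_abs s) Hb).
  destruct (Rle_lt_dec s 0) as [|Hpos].
  { assert (0 <= B ^ 2) by apply pow2_ge_0. lra. }
  assert (Hq := sqrt_lt_R0 s Hpos). assert (Hqq := sqrt_sqrt s (Rlt_le _ _ Hpos)).
  assert (sqrt s <= B).
  { apply Rmult_le_reg_r with (sqrt s); lra. }
  nra.
Qed.

Lemma functional_kern (x : R) : H2 alpha (kern x) ->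
  is_series (fun j => l (basis j) * x ^ j) (l (kern x)).
Proof.
  intro Hk.
  set (v := fun k => x ^ k). set (a := fun k => v k ^ 2 * alpha k ^ 2).
  assert (Ha : ex_series a).
  { apply ex_series_ext with (fun k => Cmod (kern x k) ^ 2 * alpha k ^ 2); [|exact Hk].
    intro k. unfold kern, a, v. now rewrite Cmod_RtoC_sq. }
  assert (Htail : forall J, is_series (fun k => Cmod (tail J v k) ^ 2 * alpha k ^ 2)
                              (Series a - sum_n a J)).
  { intro J. apply is_series_ext with (fun k => minus (a k) (Cmod (trunc J v k) ^ 2 * alpha k ^ 2)).
    - intro k. unfold tail, trunc, a, minus, plus, opp; simpl Hierarchy.AbelianGroup.opp; simpl.
      destruct (Nat.leb k J); rewrite ?Cmod_R, ?Rmult_1_r, <- ?Rabs_mult, ?Rabs_pos_eq;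
        try ring; try lra; apply Rle_0_sqr.
    - apply (is_series_minus a _ (Series a) (sum_n a J)); [now apply Series_correct|apply is_series_trunc]. }
  assert (Hd : forall J, Rabs (l (kern x) - sum_n (fun j => l (basis j) * x ^ j) J)
                 <= B * sqrt (Series a - sum_n a J)).
  { intro J. rewrite (sum_n_ext _ (fun j => v j * l (basis j))) by (intro; eq_in_R; unfold v; ring).
    rewrite <- functional_trunc.
    assert (HT : H2 alpha (tail J v)) by (eexists; apply Htail).
    replace (l (kern x)) with (l (trunc J v) + l (tail J v)).
    - replace (l (trunc J v) + l (tail J v) - l (trunc J v)) with (l (tail J v)) by ring.
      eapply Rle_trans; [now apply l_bound|]. unfold H2norm.
      rewrite (is_series_unique _ _ (Htail J)). lra.
    - rewrite <- l_add by (assumption || apply H2_trunc). f_equal.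
      apply functional_extensionality. intro k. unfold fadd, trunc, tail, kern, v.
      destruct (Nat.leb k J); ring. }
  assert (L : is_lim_seq (fun J => B * sqrt (Series a - sum_n a J)) 0).
  { replace (Finite 0) with (Rbar_mult B 0) by (simpl; f_equal; ring).
    apply is_lim_seq_scal_l. rewrite <- sqrt_0.
    apply (is_lim_seq_continuous sqrt (fun J => Series a - sum_n a J) 0).
    - apply continuity_pt_sqrt. lra.
    - replace 0 with (Series a - Series a) by ring.
      apply is_lim_seq_minus'; [apply is_lim_seq_const|exact (Series_correct _ Ha)]. }
  change (is_lim_seq (sum_n (fun j => l (basis j) * x ^ j)) (l (kern x))).
  apply is_lim_seq_ext with
    (fun J => l (kern x) - (l (kern x) - sum_n (fun j => l (basis j) * x ^ j) J)).
  { intro; eq_in_R; ring. }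
  replace (Finite (l (kern x))) with (Finite (l (kern x) - 0)) by (f_equal; ring).
  apply is_lim_seq_minus'; [apply is_lim_seq_const|].
  apply is_lim_seq_abs_0.
  apply is_lim_seq_le_le with (fun _ => 0) (fun J => B * sqrt (Series a - sum_n a J)).
  - intro J. split; [apply Rabs_pos|apply Hd].
  - apply is_lim_seq_const.
  - exact L.
Qed.

Lemma inner_basis (f : pseries) (j : nat) :
  inner alpha f (basis j) = (RtoC (alpha j ^ 2) * f j)%C.
Proof.
  unfold inner, CSeries, basis.
  assert (Z : forall k, k <> j ->
    (RtoC (alpha k ^ 2) * f k * Cconj (if Nat.eqb k j then RtoC 1 else RtoC 0))%C = RtoC 0).
  { intros k Hk. rewrite (proj2 (Nat.eqb_neq k j) Hk).
    replace (Cconj 0) with (RtoC 0) by (unfold Cconj, RtoC; simpl; f_equal; ring). ring. }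
  rewrite !(Series_single _ j) by (intros k Hk; now rewrite (Z k Hk)).
  rewrite Nat.eqb_refl.
  replace (Cconj 1) with (RtoC 1) by (unfold Cconj, RtoC; simpl; f_equal; ring).
  rewrite Cmult_1_r. symmetry. apply surjective_pairing.
Qed.

End RowVectors.

(** * The functional calculus on eigenvectors *)

Lemma RtoC_neq (x : R) : x <> 0 -> RtoC x <> RtoC 0.
Proof. intros Hx H. now apply Hx, RtoC_inj. Qed.

Lemma Cinv_one_minus_circle (a th : R) : Rabs a < 1 ->
  (/ (1 - RtoC a * circle 1 th))%C =
   ((1 - a * cos th) / (1 - 2 * a * cos th + a ^ 2),
    a * sin th / (1 - 2 * a * cos th + a ^ 2)).
Proof.
  intro Ha. assert (H := poisson_den_pos a th Ha).
  assert (T := sin2_cos2 th). unfold Rsqr in T.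
  assert (E : (1 - a * cos th) ^ 2 + (a * sin th) ^ 2 = 1 - 2 * a * cos th + a ^ 2).
  { replace ((a * sin th) ^ 2) with (a ^ 2 * (sin th * sin th)) by ring.
    replace (sin th * sin th) with (1 - cos th * cos th) by lra. ring. }
  replace (1 - RtoC a * circle 1 th)%C with ((1 - a * cos th, - (a * sin th)) : C).
  - unfold Cinv. simpl fst; simpl snd.
    replace ((1 - a * cos th) ^ 2 + (- (a * sin th)) ^ 2) with (1 - 2 * a * cos th + a ^ 2)
      by (rewrite <- E; ring).
    f_equal. field. lra.
  - unfold circle, Cminus, Cplus, Copp, Cmult, RtoC; simpl. f_equal; ring.
Qed.

Lemma Cinv_one_minus_circle_conj (a th : R) : Rabs a < 1 ->
  (/ (1 - RtoC a * circle 1 (- th)))%C =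
   ((1 - a * cos th) / (1 - 2 * a * cos th + a ^ 2),
    - (a * sin th / (1 - 2 * a * cos th + a ^ 2))).
Proof.
  intro Ha. rewrite Cinv_one_minus_circle by assumption.
  rewrite cos_neg, sin_neg. f_equal. unfold Rdiv. ring.
Qed.

Lemma circle_split (r th : R) : circle r th = (RtoC r * circle 1 th)%C.
Proof. unfold circle, Cmult, RtoC; simpl. f_equal; ring. Qed.

Lemma circle_conj (th : R) : (circle 1 th * circle 1 (- th))%C = RtoC 1.
Proof.
  unfold circle, Cmult, RtoC; simpl. rewrite cos_neg, sin_neg.
  assert (T := sin2_cos2 th). unfold Rsqr in T. f_equal; [lra|ring].
Qed.

Lemma Cmod_circle (r th : R) : 0 <= r -> Cmod (circle r th) = r.
Proof.
  intro Hr. unfold Cmod, circle; simpl.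
  assert (T := sin2_cos2 th). unfold Rsqr in T.
  replace (r * cos th * (r * cos th * 1) + r * sin th * (r * sin th * 1))
    with (r * r * (sin th * sin th + cos th * cos th)) by ring.
  rewrite T, Rmult_1_r. now apply sqrt_square.
Qed.

Lemma C_sub_neq_0 (z w : C) : Cmod z <> Cmod w -> (z - w)%C <> RtoC 0.
Proof.
  intros H E. apply H. f_equal.
  replace z with (w + (z - w))%C by ring. rewrite E. ring.
Qed.

(* Partial fractions separate the pole at mu inside the circle, which carries
   the residue, from the pole at 1/t outside. *)
Lemma mobius_cauchy_integrand (t mu r K th : R) :
  0 < t < 1 -> Rabs mu < r -> Rabs mu < 1 -> r < / t ->
  let z := circle r th in
  let m := (t - mu) / (1 - t * mu) in
  let k := (1 - t ^ 2) / (t * (1 - t * mu)) in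
  let P a := (1 - a * cos th) / (1 - 2 * a * cos th + a ^ 2) in
  let Q a := a * sin th / (1 - 2 * a * cos th + a ^ 2) in
  (/ (RtoC (2 * PI)%R * Ci) * (mobius t z * (RtoC K * / (z - RtoC mu)) * (Ci * z)))%C =
  (K / (2 * PI) * (m * P (mu / r)%R - k * (P (t * r)%R - 1)),
   K / (2 * PI) * (- m * Q (mu / r)%R - k * Q (t * r)%R)) :> C.
Proof.
  intros Ht Hmu Hmu1 Hr z m k P Q.
  assert (Hr0 : 0 < r) by (assert (H := Rabs_pos mu); lra).
  assert (Htr : t * r < 1).
  { apply Rmult_lt_reg_r with (/ t); [apply Rinv_0_lt_compat; lra|].
    replace (t * r * / t) with r by (field; lra). lra. }
  assert (Hmr : Rabs (mu / r) < 1).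
  { unfold Rdiv. rewrite Rabs_mult, (Rabs_pos_eq (/ r)) by (left; now apply Rinv_0_lt_compat).
    apply Rmult_lt_reg_r with r; [assumption|]. rewrite Rmult_assoc, Rinv_l by lra. lra. }
  assert (Htr' : Rabs (t * r) < 1) by (rewrite Rabs_pos_eq; [lra|apply Rmult_le_pos; lra]).
  assert (Htm : 0 < 1 - t * mu).
  { assert (H := Rle_abs mu). assert (0 <= Rabs mu) by apply Rabs_pos. nra. }
  assert (E1 := Cinv_one_minus_circle_conj (mu / r) th Hmr).
  assert (E2 := Cinv_one_minus_circle (t * r) th Htr').
  fold (P (mu / r)) (Q (mu / r)) in E1. fold (P (t * r)) (Q (t * r)) in E2.
  assert (Hz : Cmod z = r) by (apply Cmod_circle; lra).
  assert (N1 : (z - RtoC mu)%C <> RtoC 0).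
  { apply C_sub_neq_0. rewrite Hz, Cmod_R. lra. }
  assert (N2 : (1 - RtoC t * z)%C <> RtoC 0).
  { apply C_sub_neq_0. rewrite Cmod_mult, Hz, !Cmod_R, Rabs_R1, Rabs_pos_eq; lra. }
  assert (Nr : RtoC r <> RtoC 0) by (apply RtoC_neq; lra).
  assert (Nt : RtoC t <> RtoC 0) by (apply RtoC_neq; lra).
  assert (Npi : RtoC (2 * PI)%R <> RtoC 0) by (apply RtoC_neq; assert (H := PI_RGT_0); lra).
  assert (Ntm : (1 - RtoC t * RtoC mu)%C <> RtoC 0).
  { rewrite <- RtoC_mult, <- RtoC_minus. apply RtoC_neq. lra. }
  assert (F1 : (/ (1 - RtoC (mu / r)%R * circle 1 (- th)) = z / (z - RtoC mu))%C).
  { assert (Ez : (z * (1 - RtoC (mu / r)%R * circle 1 (- th)) = z - RtoC mu)%C).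
    { unfold z. rewrite (circle_split r), RtoC_div by lra.
      transitivity (RtoC r * circle 1 th - RtoC mu * (circle 1 th * circle 1 (- th)))%C;
        [field; assumption|]. rewrite circle_conj. ring. }
    rewrite <- Ez. field. split.
    - intro H. rewrite H in Ez. apply N1. rewrite <- Ez. ring.
    - intro H. rewrite H in Hz. rewrite Cmod_0 in Hz. lra. }
  assert (F2 : (/ (1 - RtoC (t * r)%R * circle 1 th) = / (1 - RtoC t * z))%C).
  { unfold z. rewrite (circle_split r), RtoC_mult. f_equal. ring. }
  transitivity (RtoC (K / (2 * PI))%R *
     (RtoC m * (/ (1 - RtoC (mu / r)%R * circle 1 (- th)))
      - RtoC k * (/ (1 - RtoC (t * r)%R * circle 1 th) - 1)))%C.
  - rewrite F1, F2. unfold m, k, mobius.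
    assert (Hpi := PI_RGT_0).
    assert (0 < t * (1 - t * mu)) by (apply Rmult_lt_0_compat; lra).
    rewrite !RtoC_div, !RtoC_minus, !RtoC_mult, RtoC_minus, RtoC_mult, RtoC_pow by lra.
    assert (Ni := Ci_nz).
    assert (Npi' : RtoC PI <> RtoC 0) by (apply RtoC_neq; lra).
    field. repeat split; assumption.
  - rewrite E1, E2. unfold Cmult, Cminus, Cplus, Copp, RtoC; simpl. f_equal; ring.
Qed.

Lemma mobius_not_derivable (t : R) : 0 < t < 1 ->
  ~ ex_derive (K := C_AbsRing) (V := C_NormedModule) (mobius t) (RtoC (/ t)).
Proof.
  intros Ht D. apply ex_derive_continuous in D.
  assert (N := D _ (locally_ball_norm (V := C_NormedModule) (mobius t (RtoC (/ t))) (mkposreal 1 Rlt_0_1))).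
  destruct N as [eps N].
  set (L := Cmod (mobius t (RtoC (/ t))) + 1).
  assert (HL : 0 < L) by (assert (H := Cmod_ge_0 (mobius t (RtoC (/ t)))); unfold L; lra).
  assert (Hit : 1 < / t) by (rewrite <- Rinv_1; apply Rinv_lt_contravar; lra).
  set (s := Rmin (eps / 2) ((/ t - t) / (t * L))).
  assert (Heps := cond_pos eps).
  assert (HtL : 0 < t * L) by (apply Rmult_lt_0_compat; lra).
  assert (Hs : 0 < s) by (apply Rmin_glb_lt; [lra|apply Rdiv_lt_0_compat; lra]).
  assert (Hs1 : s <= eps / 2) by apply Rmin_l.
  assert (Hs2 : s <= (/ t - t) / (t * L)) by apply Rmin_r.
  assert (B : Cmod (RtoC (/ t + s) - RtoC (/ t))%C < eps).
  { rewrite <- RtoC_minus, Cmod_R, Rabs_pos_eq; lra. }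
  specialize (N (RtoC (/ t + s)) B).
  assert (N' : Cmod (mobius t (RtoC (/ t + s)) - mobius t (RtoC (/ t)))%C < 1) by exact N.
  assert (Hts : 0 < t * s) by (apply Rmult_lt_0_compat; lra).
  assert (E : mobius t (RtoC (/ t + s)) = RtoC ((/ t + s - t) / (t * s))).
  { unfold mobius. rewrite <- RtoC_mult, <- !RtoC_minus, <- RtoC_div.
    - f_equal. field. lra.
    - replace (1 - t * (/ t + s)) with (- (t * s)) by (field; lra). lra. }
  assert (T := Cmod_triangle (mobius t (RtoC (/ t + s)) - mobius t (RtoC (/ t))) (mobius t (RtoC (/ t)))).
  replace (mobius t (RtoC (/ t + s)) - mobius t (RtoC (/ t)) + mobius t (RtoC (/ t)))%C
    with (mobius t (RtoC (/ t + s))) in T by ring.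
  rewrite E, Cmod_R, Rabs_pos_eq in T by (apply Rmult_le_pos; [lra|left; now apply Rinv_0_lt_compat]).
  rewrite E in N'.
  assert (U : L <= (/ t + s - t) / (t * s)).
  { apply Rmult_le_reg_r with (t * s); [assumption|].
    replace ((/ t + s - t) / (t * s) * (t * s)) with (/ t + s - t) by (field; lra).
    apply Rmult_le_compat_l with (r := t * L) in Hs2; [|lra].
    replace (t * L * ((/ t - t) / (t * L))) with (/ t - t) in Hs2 by (field; lra). lra. }
  unfold L in U. lra.
Qed.

Definition mobius_R (t x : R) : R := (t - x) / (1 - t * x).

Lemma mobius_den_pos (t x : R) : 0 < t < 1 -> Rabs x < 1 -> 0 < 1 - t * x.
Proof.
  intros Ht Hx. assert (H := Rle_abs x). assert (0 <= Rabs x) by apply Rabs_pos. nra.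
Qed.

Lemma mobius_R_bound (t x : R) : 0 < t < 1 -> Rabs x < 1 -> Rabs (mobius_R t x) < 1.
Proof.
  intros Ht Hx. assert (H := mobius_den_pos t x Ht Hx). apply Rabs_def2 in Hx.
  apply Rabs_def1; unfold mobius_R; apply Rmult_lt_reg_r with (1 - t * x); try assumption;
    replace ((t - x) / (1 - t * x) * (1 - t * x)) with (t - x) by (field; lra); nra.
Qed.

Lemma mobius_R_involutive (t x : R) : 0 < t < 1 -> Rabs x < 1 -> mobius_R t (mobius_R t x) = x.
Proof.
  intros Ht Hx. assert (H := mobius_den_pos t x Ht Hx).
  assert (H' := mobius_den_pos t _ Ht (mobius_R_bound t x Ht Hx)).
  unfold mobius_R in *. assert (0 < 1 - t ^ 2) by nra. field. split; [nra|].
  replace (1 - t * x - t * (t - x)) with (1 - t ^ 2) by ring. lra.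
Qed.

Lemma backward_shift_kern (x : R) : backward_shift (kern x) = fscal (RtoC x) (kern x).
Proof.
  apply functional_extensionality. intro k. unfold backward_shift, kern, fscal.
  simpl pow. apply RtoC_mult.
Qed.

Lemma calculus_kern (alpha : nat -> R) (t mu : R) (A : operator) :
  (forall k, 0 < alpha k) -> 0 < t < 1 -> Rabs mu < 1 -> H2 alpha (kern mu) ->
  is_holomorphic_calculus alpha (mobius t) backward_shift A ->
  A (kern mu) = fscal (RtoC (mobius_R t mu)) (kern mu).
Proof.
  intros Halpha Ht Hmu1 Hk [HA [r [r' [Res [Hr [HRes [Hder Hint]]]]]]].
  assert (resolvent : forall z, fsub (fscal z (kern mu)) (backward_shift (kern mu))
                         = fscal (z - RtoC mu)%C (kern mu)).
  { intro z. rewrite backward_shift_kern. apply functional_extensionality. intro k.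
    unfold fsub, fscal. ring. }
  assert (Hmu : Rabs mu < r).
  { destruct (Rlt_le_dec (Rabs mu) r) as [|Hle]; [assumption|exfalso].
    destruct (HRes (RtoC mu)) as [HV Hinv]; [now rewrite Cmod_R|].
    destruct (Hinv _ Hk) as [E _]. rewrite resolvent in E.
    rewrite (bop_scal _ _ HV) in E by assumption.
    apply (f_equal (fun f => f O)) in E. unfold fscal, kern in E. simpl in E.
    apply (RtoC_neq 1); [lra|]. rewrite <- E. ring. }
  assert (Hrt : r < / t).
  { destruct (Rlt_le_dec r (/ t)) as [|Hle]; [assumption|exfalso].
    apply (mobius_not_derivable t Ht), Hder.
    rewrite Cmod_R, Rabs_pos_eq; [lra|left; apply Rinv_0_lt_compat; lra]. }
  assert (Htr : Rabs (t * r) < 1).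
  { rewrite Rabs_pos_eq by (apply Rmult_le_pos; lra).
    replace 1 with (t * / t) by (field; lra). apply Rmult_lt_compat_l; lra. }
  assert (Hmr : Rabs (mu / r) < 1).
  { unfold Rdiv. rewrite Rabs_mult, (Rabs_pos_eq (/ r)) by (left; apply Rinv_0_lt_compat; lra).
    apply Rmult_lt_reg_r with r; [lra|]. rewrite Rmult_assoc, Rinv_l by lra. lra. }
  apply functional_extensionality. intro j.
  assert (I := Hint _ _ Hk (H2_basis alpha j)).
  set (K := alpha j ^ 2 * mu ^ j).
  set (P := fun a th => (1 - a * cos th) / (1 - 2 * a * cos th + a ^ 2)).
  set (Q := fun a th => a * sin th / (1 - 2 * a * cos th + a ^ 2)).
  set (m := mobius_R t mu) in *.
  set (k := (1 - t ^ 2) / (t * (1 - t * mu))).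
  apply (is_RInt_ext (V := C_R_NormedModule)) with (g := fun th =>
    ((K / (2 * PI) * (m * P (mu / r) th - k * (P (t * r) th - 1)),
      K / (2 * PI) * (- m * Q (mu / r) th - k * Q (t * r) th)) : C)) in I.
  2:{ intros th _. cbv zeta.
    eapply eq_trans; [|exact (mobius_cauchy_integrand t mu r K th Ht Hmu Hmu1 Hrt)].
    f_equal. f_equal. f_equal.
    set (z := circle r th).
    assert (Hz : Cmod z = r) by (apply Cmod_circle; lra).
    assert (Hzmu : (z - RtoC mu)%C <> RtoC 0) by (apply C_sub_neq_0; rewrite Hz, Cmod_R; lra).
    destruct (HRes z) as [HV Hinv]; [lra|].
    assert (ER : Res z (kern mu) = fscal (/ (z - RtoC mu))%C (kern mu)).
    { rewrite <- (proj1 (Hinv _ Hk)) at 2. rewrite resolvent.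
      rewrite (bop_scal _ _ HV) by assumption.
      apply functional_extensionality. intro i. unfold fscal. field. assumption. }
    rewrite ER, inner_basis. unfold fscal, kern, K. rewrite RtoC_mult. ring. }
  assert (IRe := is_RInt_fct_extend_fst _ _ _ _ I).
  assert (IIm := is_RInt_fct_extend_snd _ _ _ _ I).
  assert (Hpi := PI_RGT_0).
  assert (JRe : is_RInt (fun th => K / (2 * PI) * (m * P (mu / r) th - k * (P (t * r) th - 1)))
            0 (2 * PI) (K * m)).
  { replace (K * m) with (K / (2 * PI) * (m * (2 * PI) - k * (2 * PI - (2 * PI - 0) * 1)))
      by (field; lra).
    apply (is_RInt_scal (V := R_NormedModule)), (is_RInt_minus (V := R_NormedModule)).
    - apply (is_RInt_scal (V := R_NormedModule)). now apply is_RInt_poisson_re.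
    - apply (is_RInt_scal (V := R_NormedModule)), (is_RInt_minus (V := R_NormedModule)).
      + now apply is_RInt_poisson_re.
      + apply (is_RInt_const (V := R_NormedModule)). }
  assert (JIm : is_RInt (fun th => K / (2 * PI) * (- m * Q (mu / r) th - k * Q (t * r) th))
            0 (2 * PI) 0).
  { replace 0 with (K / (2 * PI) * (- m * 0 - k * 0)) at 2 by ring.
    apply (is_RInt_scal (V := R_NormedModule)), (is_RInt_minus (V := R_NormedModule));
      apply (is_RInt_scal (V := R_NormedModule)); now apply is_RInt_poisson_im. }
  assert (E : inner alpha (A (kern mu)) (basis j) = RtoC (K * m)).
  { apply injective_projections.
    - exact (eq_trans (eq_sym (is_RInt_unique _ _ _ _ IRe)) (is_RInt_unique _ _ _ _ JRe)).
    - exact (eq_trans (eq_sym (is_RInt_unique _ _ _ _ IIm)) (is_RInt_unique _ _ _ _ JIm)). }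
  rewrite inner_basis in E. unfold K in E. rewrite !RtoC_mult in E.
  assert (Ha : RtoC (alpha j ^ 2) <> RtoC 0).
  { apply RtoC_neq. assert (H := pow_lt _ 2 (Halpha j)). lra. }
  change (A (kern mu) j = RtoC m * RtoC (mu ^ j)%R)%C.
  transitivity (/ RtoC (alpha j ^ 2)%R * (RtoC (alpha j ^ 2)%R * A (kern mu) j))%C; [field; assumption|].
  rewrite E. field. assumption.
Qed.

(** * Intertwiners of the two bundles *)

Lemma l2_CV_radius_pos (a : nat -> R) : l2 a -> Rbar_lt 0 (CV_radius a).
Proof.
  intro Ha. apply Rbar_lt_le_trans with 1; [simpl; lra|].
  apply (proj1 (CV_radius_bounded a)). exists (1 + Series (fun k => a k ^ 2)). intro k.
  assert (H := term_le_Series (fun k => a k ^ 2) k (fun j => pow2_ge_0 (a j)) Ha).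
  simpl in H. rewrite pow1, Rmult_1_r.
  assert (0 <= (Rabs (a k) - 1) ^ 2) by apply pow2_ge_0.
  assert (Rabs (a k) * Rabs (a k) = a k * a k) by (rewrite <- Rabs_mult; apply Rabs_pos_eq; nra).
  assert (0 <= Rabs (a k)) by apply Rabs_pos. simpl. nra.
Qed.

(* In the dual space H2 beta the adjoint of X is the weighted composition operator
   f |-> gamma (f o phi), so row n of the matrix of X represents gamma phi^n. *)
Lemma kern_intertwiner_vanish (beta : nat -> R) (t : R) :
  (forall k, 0 < beta k) -> is_lim_seq (weight beta) 1 ->
  is_lim_seq (fun k => (INR k + 1) * (weight beta k - 1)) p_infty -> 0 < t < 1 ->
  (forall y, Rabs y < 1 -> H2 (inv_seq beta) (kern y)) ->
  exists x, Rabs x < 1 /\ forall (X : operator) (gamma : R -> C),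
    bounded_operator (inv_seq beta) X ->
    (forall y, Rabs y < 1 -> X (kern y) = fscal (gamma y) (kern (mobius_R t y))) ->
    gamma x = RtoC 0.
Proof.
  intros beta_pos weight_lim growth ht kern_H2.
  destruct (tempered_phi_vanish beta beta_pos growth t ht weight_lim) as [x [Hx vanish]].
  assert (Hx1 : Rabs x < 1) by (rewrite Rabs_pos_eq; lra).
  exists x. split; [exact Hx1|]. intros X gamma HX HXk.
  assert (inv_pos : forall k, 0 < inv_seq beta k) by (intro k; now apply Rinv_0_lt_compat).
  assert (main : forall part : C -> R,
    (forall z w, part (z + w)%C = part z + part w) ->
    (forall r z, part (RtoC r * z)%C = r * part z) ->
    (forall z, Rabs (part z) <= Cmod z) -> part (gamma x) = 0).
  { intros part part_add part_scal part_le.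
    destruct (bop_bound _ _ HX) as [M HM].
    set (F := fun n j => part (X (basis j) n)).
    assert (row : forall n,
      (ex_series (fun j => F n j ^ 2 * beta j ^ 2) /\
       Series (fun j => F n j ^ 2 * beta j ^ 2) <= Rabs M ^ 2 * beta n ^ 2) /\
      forall y, Rabs y < 1 -> is_series (fun j => F n j * y ^ j) (part (X (kern y) n))).
    { intro n. set (l := fun f => part (X f n)). assert (Hbn := beta_pos n).
      assert (l_add : forall f g, H2 (inv_seq beta) f -> H2 (inv_seq beta) g ->
                l (fadd f g) = l f + l g).
      { intros f g Hf Hg. unfold l. rewrite (bop_add _ _ HX) by assumption. apply part_add. }
      assert (l_scal : forall c f, H2 (inv_seq beta) f -> l (fscal (RtoC c) f) = c * l f).
      { intros c f Hf. unfold l. rewrite (bop_scal _ _ HX) by assumption. apply part_scal. }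
      assert (l_bound : forall f, H2 (inv_seq beta) f ->
                Rabs (l f) <= Rabs M * beta n * H2norm (inv_seq beta) f).
      { intros f Hf. eapply Rle_trans; [apply part_le|].
        eapply Rle_trans; [apply Cmod_coef_le; [exact inv_pos|now apply (bop_maps _ _ HX)]|].
        unfold inv_seq at 1. rewrite Rinv_inv.
        assert (0 <= H2norm (inv_seq beta) f) by apply sqrt_pos.
        replace (Rabs M * beta n * H2norm (inv_seq beta) f)
          with (beta n * (Rabs M * H2norm (inv_seq beta) f)) by ring.
        apply Rmult_le_compat_l; [lra|]. eapply Rle_trans; [now apply HM|].
        apply Rmult_le_compat_r; [assumption|apply Rle_abs]. }
      split.
      - destruct (functional_coef_norm _ inv_pos l _ l_add l_scal l_bound) as [E1 E2].
        assert (Ext : forall j, l (basis j) ^ 2 * (/ inv_seq beta j) ^ 2 = F n j ^ 2 * beta j ^ 2).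
        { intro j. unfold inv_seq. now rewrite Rinv_inv. }
        split; [exact (ex_series_ext _ _ Ext E1)|].
        rewrite <- (Series_ext _ _ Ext), <- Rpow_mult_distr. exact E2.
      - intros y Hy. exact (functional_kern _ l _ l_add l_scal l_bound y (kern_H2 y Hy)). }
    assert (HF : tempered beta F) by (exists (Rabs M ^ 2); intro n; apply row).
    assert (HFP : forall n y, Rabs y < 1 ->
              PSeries (F n) y = mobius_R t y ^ n * part (gamma y)).
    { intros n y Hy. unfold PSeries. rewrite (is_series_unique _ _ (proj2 (row n) y Hy)).
      rewrite HXk by assumption. unfold fscal, kern. rewrite Cmult_comm. apply part_scal. }
    assert (l2F := fun n => tempered_l2 beta beta_pos growth F n HF).
    assert (Hphi : phi_family t F).
    { intro n. apply functional_extensionality. intro j.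
      apply PSeries_ext_recip; [apply l2_CV_radius_pos, l2_mul1, l2F..|].
      exists (mkposreal 1 Rlt_0_1). intros y Hy.
      assert (Hy1 : Rabs y < 1).
      { replace y with (y - 0) by ring. exact Hy. }
      rewrite !PSeries_mul1, !HFP by auto. unfold mobius_R.
      assert (D := mobius_den_pos t y ht Hy1). simpl. field. lra. }
    rewrite <- (vanish F HF Hphi), HFP by assumption. simpl. ring. }
  apply injective_projections.
  - apply (main Re); [reflexivity|exact re_scal_l|].
    intro z. exact (Rle_trans _ _ _ (Rmax_l _ _) (Rmax_Cmod z)).
  - apply (main Im); [reflexivity|exact im_scal_l|].
    intro z. exact (Rle_trans _ _ _ (Rmax_r _ _) (Rmax_Cmod z)).
Qed.

Lemma kern_H2_inv (beta : nat -> R) (x : R) :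
  (forall k, 0 < beta k) ->
  is_lim_seq (fun k => (INR k + 1) * (weight beta k - 1)) p_infty ->
  Rabs x < 1 -> H2 (inv_seq beta) (kern x).
Proof.
  intros beta_pos growth Hx. destruct (beta_lower beta beta_pos growth) as [m [Hm Hle]].
  assert (Hx2 : Rabs (x ^ 2) < 1).
  { rewrite <- RPow_abs. assert (0 <= Rabs x) by apply Rabs_pos. simpl. nra. }
  unfold H2. apply ex_series_dominated with (fun k => (/ m) ^ 2 * (x ^ 2) ^ k).
  - intro k. unfold kern, inv_seq. rewrite Cmod_RtoC_sq.
    rewrite <- !pow_mult, (Nat.mul_comm 2 k), Rabs_pos_eq, Rmult_comm, pow_mult
      by (apply Rmult_le_pos; [rewrite pow_mult|]; apply pow2_ge_0).
    apply Rmult_le_compat_r; [apply pow2_ge_0|]. apply pow_incr.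
    split; [left; now apply Rinv_0_lt_compat|apply Rinv_le_contravar; auto].
  - exact (ex_series_scal _ _ (ex_series_geom _ Hx2)).
Qed.

Lemma backward_shift_eigen (x : R) (f : pseries) :
  backward_shift f = fscal (RtoC x) f -> f = fscal (f O) (kern x).
Proof.
  intro H. apply functional_extensionality. intro k. unfold fscal, kern.
  induction k as [|k IH]; [simpl; ring|].
  assert (E : f (S k) = (RtoC x * f k)%C) by exact (f_equal (fun g => g k) H).
  rewrite E, IH. simpl pow. rewrite RtoC_mult. ring.
Qed.

Theorem theorem4p5 (beta : nat -> R)
    (beta_pos : forall k : nat, 0 < beta k)
    (beta_0 : beta O = 1)
    (weight_lim : is_lim_seq (weight beta) (Finite 1))
    (t : R) (ht : 0 < t < 1)
    (strict : strictly_cyclic beta Mz)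
    (growth : is_lim_seq (fun k : nat => (INR k + 1) * (weight beta k - 1)) p_infty)
    (phiS : operator)
    (hphiS : is_holomorphic_calculus (inv_seq beta) (mobius t) backward_shift phiS) :
  ~ similar (inv_seq beta) 
    (kernel_bundle (inv_seq beta) backward_shift)
    (kernel_bundle (inv_seq beta) phiS).
Proof.
  intros [X [[HX _] Hsim]].
  assert (kern_H2 := fun y => kern_H2_inv beta y beta_pos growth).
  assert (inv_pos : forall k, 0 < inv_seq beta k) by (intro k; now apply Rinv_0_lt_compat).
  assert (fibre : forall y, Rabs y < 1 -> exists b : C, b <> RtoC 0 /\
            X (kern y) = fscal (/ b)%C (kern (mobius_R t y))).
  { intros y Hy. assert (Hm := mobius_R_bound t y ht Hy).
    assert (Hw : Cmod (RtoC y) < 1) by now rewrite Cmod_R.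
    destruct (proj1 (Hsim _ Hw (kern (mobius_R t y)))) as [f [[Hf Ef] EX]].
    { split; [now apply kern_H2|].
      rewrite (calculus_kern _ t _ phiS inv_pos ht Hm (kern_H2 _ Hm) hphiS).
      now rewrite mobius_R_involutive. }
    rewrite (backward_shift_eigen y f Ef), (bop_scal _ _ HX) in EX by now apply kern_H2.
    assert (Hb : f O <> RtoC 0).
    { intro H0. apply (f_equal (fun g => g O)) in EX. unfold fscal in EX.
      rewrite H0, Cmult_0_l in EX. unfold kern in EX. simpl in EX.
      symmetry in EX. revert EX. apply RtoC_neq. lra. }
    exists (f O). split; [exact Hb|]. rewrite <- EX.
    apply functional_extensionality. intro k. unfold fscal. field. exact Hb. }
  destruct (kern_intertwiner_vanish beta t beta_pos weight_lim growth ht (fun y => kern_H2 y))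
    as [x [Hx vanish]].
  set (gamma := fun y => X (kern y) O).
  assert (Hgamma : gamma x = RtoC 0).
  { apply (vanish X gamma HX). intros y Hy. destruct (fibre y Hy) as [b [_ E]].
    unfold gamma. rewrite E. f_equal. unfold fscal, kern. simpl. ring. }
  destruct (fibre x Hx) as [b [Hb E]].
  unfold gamma in Hgamma. rewrite E in Hgamma. unfold fscal, kern in Hgamma. simpl in Hgamma.
  rewrite Cmult_1_r in Hgamma.
  apply C1_nz. rewrite <- (Cinv_r b Hb), Hgamma. ring.
Qed.
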